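(* Let $R$ be an exceptional prime ring, let $L$ be a noncentral Lie ideal of $R$ (i.e. $L\not\subseteq Z(R)$), and let $a_1,\ldots,a_n\in R$ ($n\ge 1$). (i) If $L$ is either abelian or nonabelian of Type I, then $[a_1,a_2,\ldots,a_n,L]\subseteq Z(R)$ if and only if one of $a_1,\ldots,a_n$ lies in $[RC,RC]$. (ii) If $L$ is nonabelian of Type II, then $[a_1,a_2,\ldots,a_n,L]\subseteq Z(R)$ if and only if either $a_n\in Z(R)$ or one of $a_1,\ldots,a_{n-1}$ lies in $[RC,RC]$.
   Context: Rings are associative, not necessarily unital; $Z(R)$ is the center of $R$. $[a,b]:=ab-ba$; for additive subgroups $A,B$ of a ring, $AB$ (resp. $[A,B]$) is the additive subgroup generated by all $ab$ (resp. $[a,b]$), $a\in A$, $b\in B$. For elements, $[a_1,\ldots,a_n,x]:=[a_1,[a_2,[\cdots,[a_n,x]\cdots]]]$, and $[a_1,\ldots,a_n,L]$ is the set of all $[a_1,\ldots,a_n,x]$ with $x\in L$. A Lie ideal of $R$ is an additive subgroup $L$ with $[L,R]\subseteq L$; it is abelian if $[L,L]=0$ and nonabelian otherwise. For a prime ring $R$, let $Q_s(R)$ be its Martindale symmetric ring of quotients and $C$ (the extended centroid) the center of $Q_s(R)$, which is a field; products such as $RC$, $LC$ are taken in $Q_s(R)$. A prime ring $R$ is called exceptional if both $\mathrm{char}\,R=2$ and $\dim_C RC=4$. A nonabelian Lie ideal $L$ of an exceptional prime ring $R$ is of Type I if $LC=[RC,RC]$ and of Type II if $LC=RC$. *)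

(* Defs.v *)
From HB Require Import structures.
From mathcomp Require Import all_boot all_algebra.
From mathcomp Require Import boolp classical_sets.
Set Implicit Arguments.
Unset Strict Implicit.
Unset Printing Implicit Defensive.
Import GRing.Theory.
Local Open Scope ring_scope.
Local Open Scope classical_set_scope.
Local Open Scope quotient_scope.

(* Associative rings, not necessarily unital nor commutative. *)
HB.mixin Record Zmodule_isRng R of GRing.Zmodule R := {
  rmul : R -> R -> R;
  rmulA : associative rmul;
  rmulDl : left_distributive rmul +%R;
  rmulDr : right_distributive rmul +%R }.

#[short(type="rngType")]
HB.structure Definition Rng := { R of Zmodule_isRng R & GRing.Zmodule R }.

Notation "x ** y" := (rmul x y) (at level 40, left associativity) : ring_scope.

HB.mixin Record Rng_isPrime R of Rng R := {
  rng_nontrivial : exists x : R, x <> 0;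
  rng_prime : forall a b : R, (forall x : R, a ** x ** b = 0) ->
                a = 0 \/ b = 0 }.

#[short(type="primeRngType")]
HB.structure Definition PrimeRng := { R of Rng_isPrime R & Rng R }.

Definition additive_subgroup (V : zmodType) (G : set V) : Prop :=
  G 0 /\ (forall x y, G x -> G y -> G (x - y)).

Definition additive_span (V : zmodType) (S : set V) : set V :=
  [set x | forall G : set V, additive_subgroup G -> S `<=` G -> G x].

Definition bracket (R : rngType) (a b : R) : R := a ** b - b ** a.

Definition set_mul (R : rngType) (A B : set R) : set R :=
  additive_span [set x | exists a b, [/\ A a, B b & x = a ** b]].

Definition set_bracket (R : rngType) (A B : set R) : set R :=
  additive_span [set x | exists a b, [/\ A a, B b & x = bracket a b]].

Definition rng_center (R : rngType) : set R :=
  [set z | forall x : R, z ** x = x ** z].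

Definition iter_bracket (R : rngType) (a : seq R) (L : set R) : set R :=
  [set foldr (@bracket R) x a | x in L].

Definition lie_ideal (R : rngType) (L : set R) : Prop :=
  additive_subgroup L /\ set_bracket L [set: R] `<=` L.

Definition lie_abelian (R : rngType) (L : set R) : Prop :=
  set_bracket L L = [set 0].

Definition ideal (R : rngType) (I : set R) : Prop :=
  additive_subgroup I /\ (forall r x, I x -> I (r ** x) /\ I (x ** r)).

Definition nonzero_ideal (R : rngType) (I : set R) : Prop :=
  ideal I /\ (exists x, I x /\ x <> 0).

Section Closure.
Variable R : rngType.
Implicit Types (x y : R) (I J : set R).

Lemma rmul0 x : x ** 0 = 0.
Proof. by apply: (addrI (x ** 0)); rewrite -rmulDr !addr0. Qed.

Lemma rmul_0 x : 0 ** x = 0.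
Proof. by apply: (addrI (0 ** x)); rewrite -rmulDl !addr0. Qed.

Lemma rmulN x y : x ** (- y) = - (x ** y).
Proof. by apply: (addrI (x ** y)); rewrite -rmulDr !subrr rmul0. Qed.

Lemma rmul_N x y : (- x) ** y = - (x ** y).
Proof. by apply: (addrI (x ** y)); rewrite -rmulDl !subrr rmul_0. Qed.

Lemma subgroupN (G : set R) x : additive_subgroup G -> G x -> G (- x).
Proof. by case=> G0 GB Gx; rewrite -(sub0r x); apply: GB. Qed.

Lemma subgroupD (G : set R) x y :
  additive_subgroup G -> G x -> G y -> G (x + y).
Proof.
by move=> hG Gx Gy; rewrite -(opprK y); apply: hG.2 => //; apply: subgroupN.
Qed.

Lemma additive_span_subgroup (S : set R) : additive_subgroup (additive_span S).
Proof.
split=> [G [] //|x y Sx Sy G hG SG].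
by apply: hG.2; [exact: Sx|exact: Sy].
Qed.

Lemma sub_additive_span (S : set R) : S `<=` additive_span S.
Proof. by move=> x Sx G _; apply. Qed.

Lemma ideal_setT : ideal [set: R].
Proof. by []. Qed.

Lemma ideal_setI I J : ideal I -> ideal J -> ideal (I `&` J).
Proof.
move=> [[I0 IB] IM] [[J0 JB] JM]; split; first split=> //.
  by move=> x y [Ix Jx] [Iy Jy]; split; [apply: IB|apply: JB].
by move=> r x [/(IM r) [? ?] /(JM r) [? ?]].
Qed.

Lemma ideal_set_mul I J : ideal I -> ideal J -> ideal (set_mul I J).
Proof.
move=> [hI IM] [hJ JM]; split; first exact: additive_span_subgroup.
move=> r x xIJ; split.
- apply: (xIJ [set x | set_mul I J (r ** x)]) => [|_ [i [j [Ii Jj ->]]]].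
    split=> [|y z hy hz] /=.
      by rewrite rmul0; apply: (additive_span_subgroup _).1.
    by rewrite rmulDr rmulN; apply: (additive_span_subgroup _).2.
  apply: sub_additive_span; exists (r ** i), j.
  by rewrite rmulA; split=> //; case: (IM r i Ii).
- apply: (xIJ [set x | set_mul I J (x ** r)]) => [|_ [i [j [Ii Jj ->]]]].
    split=> [|y z hy hz] /=.
      by rewrite rmul_0; apply: (additive_span_subgroup _).1.
    by rewrite rmulDl rmul_N; apply: (additive_span_subgroup _).2.
  apply: sub_additive_span; exists i, (j ** r).
  by rewrite rmulA; split=> //; case: (JM r j Jj).
Qed.

Lemma set_mul_subl I J : ideal I -> set_mul I J `<=` I.
Proof.
move=> [hI IM] x; apply=> // _ [i [j [Ii _ ->]]].
by case: (IM j i Ii).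
Qed.

Lemma set_mul_subr I J : ideal J -> set_mul I J `<=` J.
Proof.
move=> [hJ JM] x; apply=> // _ [i [j [_ Jj ->]]].
by case: (JM i j Jj).
Qed.

End Closure.

Section PrimeIdeals.
Variable R : primeRngType.
Implicit Types I J : set R.

Lemma nonzero_ideal_setT : nonzero_ideal [set: R].
Proof. by split=> //; have [x hx] := @rng_nontrivial R; exists x. Qed.

Lemma nonzero_ideal_mul I J :
  nonzero_ideal I -> nonzero_ideal J -> nonzero_ideal (set_mul I J).
Proof.
move=> [hI [a [Ia a0]]] [hJ [b [Jb b0]]].
split; first exact: ideal_set_mul.
apply: contrapT => /forallNP none.
have [] // : a = 0 \/ b = 0.
apply: rng_prime => x; apply: contrapT => axb; apply: (none (a ** x ** b)).
split=> //; apply: sub_additive_span; exists (a ** x), b; split=> //.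
by case: (hI.2 x a Ia).
Qed.

Lemma nonzero_ideal_setI I J :
  nonzero_ideal I -> nonzero_ideal J -> nonzero_ideal (I `&` J).
Proof.
move=> hI hJ; split; first exact: ideal_setI hI.1 hJ.1.
have [_ [x [xIJ x0]]] := nonzero_ideal_mul hI hJ; exists x; split=> //.
by split; [exact: set_mul_subl hI.1 _ xIJ|exact: set_mul_subr hJ.1 _ xIJ].
Qed.

End PrimeIdeals.

(* Balanced pairs representing the elements q of the Martindale symmetric ring *)
(* of quotients: bp_l is the right module map x |-> q x and bp_r the left      *)
(* module map x |-> x q, both defined on a nonzero ideal bp_dom.  Only the     *)
(* values of bp_l and bp_r on bp_dom are meaningful.                           *)
Record balanced_pair (R : primeRngType) := BalancedPair {
  bp_dom : set R;
  bp_l : R -> R;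
  bp_r : R -> R;
  bp_ideal : nonzero_ideal bp_dom;
  bp_lD : forall x y, bp_dom x -> bp_dom y -> bp_l (x + y) = bp_l x + bp_l y;
  bp_rD : forall x y, bp_dom x -> bp_dom y -> bp_r (x + y) = bp_r x + bp_r y;
  bp_lM : forall x r, bp_dom x -> bp_l (x ** r) = bp_l x ** r;
  bp_rM : forall r x, bp_dom x -> bp_r (r ** x) = r ** bp_r x;
  bp_lr : forall x y, bp_dom x -> bp_dom y -> x ** bp_l y = bp_r x ** y }.

HB.instance Definition _ (R : primeRngType) := gen_eqMixin (balanced_pair R).
HB.instance Definition _ (R : primeRngType) :=
  gen_choiceMixin (balanced_pair R).

Section Quotients.
Variable R : primeRngType.
Implicit Types (p q s : balanced_pair R) (K : set R).

Definition agree_on K p q : Prop :=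
  [/\ K `<=` bp_dom p, K `<=` bp_dom q &
      forall x, K x -> bp_l p x = bp_l q x /\ bp_r p x = bp_r q x].

Definition bp_equiv p q : bool := `[< exists2 K, nonzero_ideal K & agree_on K p q >].

Lemma bp_equivI K p q : nonzero_ideal K -> agree_on K p q -> bp_equiv p q.
Proof. by move=> hK hpq; apply/asboolP; exists K. Qed.

Lemma bp_equiv_refl : reflexive bp_equiv.
Proof. by move=> p; apply: (bp_equivI (bp_ideal p)); split. Qed.

Lemma bp_equiv_sym : symmetric bp_equiv.
Proof.
suff sym p q : bp_equiv p q -> bp_equiv q p by move=> p q; apply/idP/idP; exact: sym.
move=> /asboolP[K hK [Kp Kq e]]; apply: (bp_equivI hK); split=> // x /e [-> ->] //.
Qed.

Lemma bp_equiv_trans : transitive bp_equiv.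
Proof.
move=> q p s /asboolP[K hK [Kp Kq e]] /asboolP[M hM [Mq Ms e']].
apply: (bp_equivI (nonzero_ideal_setI hK hM)); split=> [x [/Kp]|x [_ /Ms]|x [Kx Mx]] //.
by have [-> ->] := e x Kx; exact: e'.
Qed.

Canonical bp_equiv_rel :=
  EquivRel bp_equiv bp_equiv_refl bp_equiv_sym bp_equiv_trans.

Definition bp_mult (r : R) : balanced_pair R.
Proof.
refine (@BalancedPair R [set: R] (rmul r) (fun x => x ** r)
  (nonzero_ideal_setT R) _ _ _ _ _) => *.
- exact: rmulDr.
- exact: rmulDl.
- exact: rmulA.
- by rewrite rmulA.
- exact: rmulA.
Defined.

Definition bp_zero : balanced_pair R.
Proof.
refine (@BalancedPair R [set: R] (fun=> 0) (fun=> 0)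
  (nonzero_ideal_setT R) _ _ _ _ _) => *.
- by rewrite addr0.
- by rewrite addr0.
- by rewrite rmul_0.
- by rewrite rmul0.
- by rewrite rmul0 rmul_0.
Defined.

Definition bp_one : balanced_pair R.
Proof.
by refine (@BalancedPair R [set: R] id id (nonzero_ideal_setT R) _ _ _ _ _).
Defined.

Definition bp_opp p : balanced_pair R.
Proof.
refine (@BalancedPair R (bp_dom p) (fun x => - bp_l p x) (fun x => - bp_r p x)
  (bp_ideal p) _ _ _ _ _) => [x y hx hy|x y hx hy|x r hx|r x hx|x y hx hy].
- by rewrite bp_lD// opprD.
- by rewrite bp_rD// opprD.
- by rewrite bp_lM// rmul_N.
- by rewrite bp_rM// rmulN.
- by rewrite rmulN rmul_N bp_lr.
Defined.

Definition bp_add p q : balanced_pair R.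
Proof.
refine (@BalancedPair R (bp_dom p `&` bp_dom q)
  (fun x => bp_l p x + bp_l q x) (fun x => bp_r p x + bp_r q x)
  (nonzero_ideal_setI (bp_ideal p) (bp_ideal q)) _ _ _ _ _)
  => [x y [px qx] [py qy]|x y [px qx] [py qy]|x r [px qx]|r x [px qx]
     |x y [px qx] [py qy]].
- by rewrite !bp_lD// addrACA.
- by rewrite !bp_rD// addrACA.
- by rewrite !bp_lM// rmulDl.
- by rewrite !bp_rM// rmulDr.
- by rewrite rmulDl rmulDr !bp_lr.
Defined.

Lemma bp_l0 p : bp_l p 0 = 0.
Proof.
have h0 := (bp_ideal p).1.1.1.
by apply: (addrI (bp_l p 0)); rewrite -bp_lD// !addr0.
Qed.

Lemma bp_r0 p : bp_r p 0 = 0.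
Proof.
have h0 := (bp_ideal p).1.1.1.
by apply: (addrI (bp_r p 0)); rewrite -bp_rD// !addr0.
Qed.

Lemma bp_lN p x : bp_dom p x -> bp_l p (- x) = - bp_l p x.
Proof.
move=> px; have pNx := subgroupN (bp_ideal p).1.1 px.
by apply: (addrI (bp_l p x)); rewrite -bp_lD// !subrr bp_l0.
Qed.

Lemma bp_rN p x : bp_dom p x -> bp_r p (- x) = - bp_r p x.
Proof.
move=> px; have pNx := subgroupN (bp_ideal p).1.1 px.
by apply: (addrI (bp_r p x)); rewrite -bp_rD// !subrr bp_r0.
Qed.

Lemma bp_l_dom q K M x : K `<=` bp_dom q -> ideal K -> ideal M ->
  set_mul K M x -> M (bp_l q x).
Proof.
move=> Kq hK hM xKM.
have [] // : (K `&` [set y | M (bp_l q y)]) x.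
apply: xKM => [|_ [k [m [Kk Mm ->]]]].
  split; first by split; [exact: hK.1.1|rewrite /= bp_l0; exact: hM.1.1].
  move=> y z [Ky My] [Kz Mz]; split; first exact: hK.1.2.
  rewrite /= bp_lD ?bp_lN; [exact: hM.1.2|exact: Kq|exact: Kq|].
  by apply: subgroupN (bp_ideal q).1.1 _; exact: Kq.
split; first by case: (hK.2 m k Kk).
by rewrite /= bp_lM; [case: (hM.2 (bp_l q k) m Mm)|exact: Kq].
Qed.

Lemma bp_r_dom p K M x : K `<=` bp_dom p -> ideal K -> ideal M ->
  set_mul M K x -> M (bp_r p x).
Proof.
move=> Kp hK hM xMK.
have [] // : (K `&` [set y | M (bp_r p y)]) x.
apply: xMK => [|_ [m [k [Mm Kk ->]]]].
  split; first by split; [exact: hK.1.1|rewrite /= bp_r0; exact: hM.1.1].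
  move=> y z [Ky My] [Kz Mz]; split; first exact: hK.1.2.
  rewrite /= bp_rD ?bp_rN; [exact: hM.1.2|exact: Kp|exact: Kp|].
  by apply: subgroupN (bp_ideal p).1.1 _; exact: Kp.
split; first by case: (hK.2 m k Kk).
by rewrite /= bp_rM; [case: (hM.2 (bp_r p k) m Mm)|exact: Kp].
Qed.

Lemma bp_mul_dom p q x : set_mul (bp_dom q) (bp_dom p) x ->
  [/\ bp_dom p x, bp_dom q x, bp_dom p (bp_l q x) & bp_dom q (bp_r p x)].
Proof.
have hp := (bp_ideal p).1; have hq := (bp_ideal q).1 => hx; split.
- exact: set_mul_subr hp _ hx.
- exact: set_mul_subl hq _ hx.
- exact: bp_l_dom hx.
- exact: bp_r_dom hx.
Qed.

(* The domain J I, with I and J those of p and q, is chosen so that q x and *)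
(* x p remain in the domains of p and q respectively.                       *)
Definition bp_mul p q : balanced_pair R.
Proof.
refine (@BalancedPair R (set_mul (bp_dom q) (bp_dom p))
  (fun x => bp_l p (bp_l q x)) (fun x => bp_r q (bp_r p x))
  (nonzero_ideal_mul (bp_ideal q) (bp_ideal p)) _ _ _ _ _)
  => [x y /bp_mul_dom[? ? ? ?] /bp_mul_dom[? ? ? ?]
     |x y /bp_mul_dom[? ? ? ?] /bp_mul_dom[? ? ? ?]
     |x r /bp_mul_dom[? ? ? ?]|r x /bp_mul_dom[? ? ? ?]
     |x y /bp_mul_dom[? ? ? ?] /bp_mul_dom[? ? ? ?]].
- by rewrite !bp_lD.
- by rewrite !bp_rD.
- by rewrite !bp_lM.
- by rewrite !bp_rM.
- by rewrite bp_lr// bp_lr.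
Defined.

Definition Qs := {eq_quot bp_equiv_rel}.

HB.instance Definition _ := Choice.on Qs.
HB.instance Definition _ := Quotient.on Qs.
HB.instance Definition _ : EqQuotient _ bp_equiv_rel Qs := EqQuotient.on Qs.

Lemma Qs_eq p q K : nonzero_ideal K -> agree_on K p q -> \pi_Qs p = \pi_Qs q.
Proof. by move=> hK e; apply/eqmodP; exact: bp_equivI e. Qed.

Lemma Qs_eqP p q : \pi_Qs p = \pi_Qs q ->
  exists2 K, nonzero_ideal K & agree_on K p q.
Proof. by move/eqmodP/asboolP. Qed.

Definition Qs_opp := lift_op1 Qs bp_opp.
Definition Qs_add := lift_op2 Qs bp_add.
Definition Qs_mul := lift_op2 Qs bp_mul.

Lemma pi_Qs_opp : {morph \pi_Qs : p / bp_opp p >-> Qs_opp p}.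
Proof.
move=> p; unlock Qs_opp; have [K hK [Kp Kq e]] := Qs_eqP (esym (reprK (\pi_Qs p))).
by apply: (Qs_eq hK); split=> // x /e [/= -> ->].
Qed.
Canonical pi_Qs_opp_morph := PiMorph1 pi_Qs_opp.

Lemma pi_Qs_add : {morph \pi_Qs : p q / bp_add p q >-> Qs_add p q}.
Proof.
move=> p q; unlock Qs_add.
have [K hK [Kp Kp' e]] := Qs_eqP (esym (reprK (\pi_Qs p))).
have [M hM [Mq Mq' e']] := Qs_eqP (esym (reprK (\pi_Qs q))).
apply: (Qs_eq (nonzero_ideal_setI hK hM)); split=> [x [Kx Mx]|x [Kx Mx]|x [Kx Mx]].
- by split; [exact: Kp|exact: Mq].
- by split; [exact: Kp'|exact: Mq'].
- by have [/= -> ->] := e x Kx; have [-> ->] := e' x Mx.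
Qed.
Canonical pi_Qs_add_morph := PiMorph2 pi_Qs_add.

Lemma set_mulS (A B A' B' : set R) :
  A `<=` A' -> B `<=` B' -> set_mul A B `<=` set_mul A' B'.
Proof.
move=> sA sB x; apply; first exact: additive_span_subgroup.
move=> _ [a [b [Aa Bb ->]]]; apply: sub_additive_span; exists a, b.
by split=> //; [exact: sA|exact: sB].
Qed.

Lemma pi_Qs_mul : {morph \pi_Qs : p q / bp_mul p q >-> Qs_mul p q}.
Proof.
move=> p q; unlock Qs_mul.
have [K hK [Kp Kp' e]] := Qs_eqP (esym (reprK (\pi_Qs p))).
have [M hM [Mq Mq' e']] := Qs_eqP (esym (reprK (\pi_Qs q))).
apply: (Qs_eq (nonzero_ideal_mul hM hK)); split; [exact: set_mulS|exact: set_mulS|].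
move=> x hx /=.
have Mx := set_mul_subl hM.1 hx; have Kx := set_mul_subr hK.1 hx.
have [<- _] := e' x Mx; have [_ <-] := e x Kx.
have [<- _] := e _ (bp_l_dom Mq hM.1 hK.1 hx).
by have [_ <-] := e' _ (bp_r_dom Kp hK.1 hM.1 hx).
Qed.
Canonical pi_Qs_mul_morph := PiMorph2 pi_Qs_mul.

Lemma Qs_ext p q : bp_l p =1 bp_l q -> bp_r p =1 bp_r q -> \pi_Qs p = \pi_Qs q.
Proof.
move=> el er; apply: (Qs_eq (nonzero_ideal_setI (bp_ideal p) (bp_ideal q))).
by split=> x [px qx].
Qed.

Lemma Qs_addA : associative Qs_add.
Proof.
elim/quotW=> p; elim/quotW=> q; elim/quotW=> s; rewrite !piE.
by apply: Qs_ext => x /=; rewrite addrA.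
Qed.

Lemma Qs_addC : commutative Qs_add.
Proof.
elim/quotW=> p; elim/quotW=> q; rewrite !piE.
by apply: Qs_ext => x /=; rewrite addrC.
Qed.

Lemma Qs_add0 : left_id (\pi_Qs bp_zero) Qs_add.
Proof. by elim/quotW=> p; rewrite !piE; apply: Qs_ext => x /=; rewrite add0r. Qed.

Lemma Qs_addN : left_inverse (\pi_Qs bp_zero) Qs_opp Qs_add.
Proof. by elim/quotW=> p; rewrite !piE; apply: Qs_ext => x /=; rewrite addNr. Qed.

HB.instance Definition _ :=
  GRing.isZmodule.Build Qs Qs_addA Qs_addC Qs_add0 Qs_addN.

Lemma Qs_mulA : associative Qs_mul.
Proof.
by elim/quotW=> p; elim/quotW=> q; elim/quotW=> s; rewrite !piE; exact: Qs_ext.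
Qed.

Lemma Qs_mul1l : left_id (\pi_Qs bp_one) Qs_mul.
Proof. by elim/quotW=> p; rewrite !piE; exact: Qs_ext. Qed.

Lemma Qs_mul1r : right_id (\pi_Qs bp_one) Qs_mul.
Proof. by elim/quotW=> p; rewrite !piE; exact: Qs_ext. Qed.

Lemma Qs_mulDl : left_distributive Qs_mul Qs_add.
Proof.
elim/quotW=> p; elim/quotW=> q; elim/quotW=> s; rewrite !piE.
set a := bp_mul _ _; set b := bp_add _ _.
apply: (Qs_eq (nonzero_ideal_setI (bp_ideal a) (bp_ideal b))).
split=> [x []|x []|x [_ [/= /bp_mul_dom[? ? ? ?] /bp_mul_dom[? ? ? ?]]]] //.
by rewrite bp_rD.
Qed.

Lemma Qs_mulDr : right_distributive Qs_mul Qs_add.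
Proof.
elim/quotW=> p; elim/quotW=> q; elim/quotW=> s; rewrite !piE.
set a := bp_mul _ _; set b := bp_add _ _.
apply: (Qs_eq (nonzero_ideal_setI (bp_ideal a) (bp_ideal b))).
split=> [x []|x []|x [_ [/= /bp_mul_dom[? ? ? ?] /bp_mul_dom[? ? ? ?]]]] //.
by rewrite bp_lD.
Qed.

Lemma Qs_1_neq0 : \pi_Qs bp_one != 0 :> Qs.
Proof.
apply/eqP => /Qs_eqP[K [_ [x [Kx x0]]] [_ _ e]].
by have [/= ? _] := e x Kx.
Qed.

HB.instance Definition _ := GRing.Zmodule_isNzRing.Build Qs
  Qs_mulA Qs_mul1l Qs_mul1r Qs_mulDl Qs_mulDr Qs_1_neq0.

HB.instance Definition _ := Zmodule_isRng.Build Qs Qs_mulA Qs_mulDl Qs_mulDr.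

Definition to_Qs (r : R) : Qs := \pi_Qs (bp_mult r).

Lemma to_QsD (r s : R) : to_Qs (r + s) = to_Qs r + to_Qs s.
Proof.
rewrite /to_Qs [RHS]piE; apply: Qs_ext => x /=; [exact: rmulDl|exact: rmulDr].
Qed.

Lemma to_QsM (r s : R) : to_Qs (r ** s) = to_Qs r ** to_Qs s.
Proof.
rewrite /to_Qs [RHS]piE; apply: Qs_ext => x /=; by rewrite rmulA.
Qed.

Lemma to_Qs_inj : injective to_Qs.
Proof.
move=> r s /Qs_eqP[K [hK [a [Ka a0]]] [_ _ e]].
have [] // : r - s = 0 \/ a = 0; last by move/subr0_eq.
apply: rng_prime => x.
have [/= e1 _] := e (x ** a) (hK.2 x a Ka).1.
by rewrite -rmulA rmulDl rmul_N e1 subrr.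
Qed.

Lemma Qs_rmulE (x y : Qs) : x ** y = x * y.
Proof. by []. Qed.

Lemma Qs_mul_to_Qs p x : bp_dom p x -> \pi_Qs p ** to_Qs x = to_Qs (bp_l p x).
Proof.
move=> px; rewrite /to_Qs [LHS]piE.
apply: (Qs_eq (bp_ideal (bp_mul p (bp_mult x)))); split=> // y.
move=> /bp_mul_dom[/= py _ _ _]; split; first exact: bp_lM.
by rewrite bp_lr.
Qed.

Lemma to_Qs_mul_Qs p x : bp_dom p x -> to_Qs x ** \pi_Qs p = to_Qs (bp_r p x).
Proof.
move=> px; rewrite /to_Qs [LHS]piE.
apply: (Qs_eq (bp_ideal (bp_mul (bp_mult x) p))); split=> // y.
move=> /bp_mul_dom[/= _ py _ _]; split; last exact: bp_rM.
by rewrite bp_lr.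
Qed.

End Quotients.

Section Exceptional.
Variable R : primeRngType.

Definition extended_centroid : set (Qs R) := @rng_center (Qs R).

Definition central_closure (A : set R) : set (Qs R) :=
  set_mul (@to_Qs R @` A) extended_centroid.

Definition RC : set (Qs R) := central_closure [set: R].

(* V is a C-subspace of Qs R with a C-basis of d elements. *)
Definition has_C_dim (V : set (Qs R)) (d : nat) : Prop :=
  exists b : 'I_d -> Qs R, (forall i, V (b i)) /\
    forall x, V x -> exists! c : {ffun 'I_d -> Qs R},
      (forall i, extended_centroid (c i)) /\ x = \sum_(i < d) c i ** b i.

(* As R is nonzero, its characteristic is 2 as soon as 2R = 0. *)
Definition exceptional : Prop :=
  (forall x : R, x *+ 2 = 0) /\ has_C_dim RC 4.

Definition type_I (L : set R) : Prop :=
  ~ lie_abelian L /\ central_closure L = set_bracket RC RC.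

Definition type_II (L : set R) : Prop :=
  ~ lie_abelian L /\ central_closure L = RC.

End Exceptional.

Arguments rng_center : clear implicits.
Arguments RC : clear implicits.
Arguments exceptional : clear implicits.

(* Main.v *)
(* Let A = RC, C the center of Q_s(R).  Although A is not assumed unital, five *)
(* elements of A are always C-dependent, which yields an idempotent of A, and  *)
(* its Peirce decomposition forces 1 to lie in A.  In characteristic 2,        *)
(* [x, [x, a]] = [x^2, a]; if 1, x, x^2 are independent then [x, A] is a line  *)
(* C u with [x, u] = e u, so x^2 - e x centralizes A.  Hence every element of  *)
(* A is quadratic over C.  Choosing x with x^2 - x in C, ad x is a projection, *)
(* A = C + C x + [x, A], and the coefficient t of x (the reduced trace)        *)
(* satisfies                                                                   *)
(*      [a, b] = t(a) b + t(b) a  mod C   and   ker t = [A, A].                *)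
(* So [a_1, ..., a_n, w] = t(a_1) ... t(a_n) w mod C whenever t(w) = 0.  If L  *)
(* is abelian and w in L, then 0 = [w, [w, r]] = t(w) [w, r] for all r in R,   *)
(* whence t(w) = 0; in type II one applies the formula to w = [a_n, v].        *)

(* Behind the theorem is a quaternion algebra: RC has dimension four over the field C, and modulo C
   its commutators are governed by a C-valued function t, the reduced trace ([trace_form]).
   Bracketing with a multiplies an element w of trace zero by t(a) modulo C, and a central error is
   erased by the next bracket; this is [iter_comm_trace]. As C is a field, the iterated bracket of a
   noncentral w of trace zero is central exactly when some t(a_i) = 0, that is, when some a_i lies
   in [RC,RC].

   In (i) all of L has trace zero, and L contains a noncentral w. In (ii) the trace-zero elements
   are the innermost brackets [a_n,w]: if no earlier a_i has trace zero, all of them are central,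
   and LC = RC then makes a_n central by [comm_central].

   The trace comes from [A1] (RC is unital), [quadratic] (every element is quadratic over C) and
   [ex_separable] (a noncentral x with x^2 - x in C). [Qs_central_inv] makes C a field, and
   [steinitz] turns the dimension into dependence relations. *)
Require Import Defs.
From mathcomp Require Import all_boot all_algebra.
From mathcomp Require Import boolp classical_sets.
Set Implicit Arguments.
Unset Strict Implicit.
Unset Printing Implicit Defensive.
Import GRing.Theory.
Local Open Scope ring_scope.
Local Open Scope classical_set_scope.
Local Open Scope quotient_scope.

(** * Linear dependence over the center *)

Section Center.
Variable Q : nzRingType.

(** For Q = [Qs R] this is convertible with [extended_centroid], so facts pass between the two
    notations without rewriting. *)
Definition central : set Q := [set z | forall q, z * q = q * z].

Lemma central0 : central 0.
Proof. by move=> q; rewrite mul0r mulr0. Qed.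

Lemma central1 : central 1.
Proof. by move=> q; rewrite mul1r mulr1. Qed.

Lemma centralN c : central c -> central (- c).
Proof. by move=> hc q; rewrite mulNr mulrN hc. Qed.

Lemma centralD c d : central c -> central d -> central (c + d).
Proof. by move=> hc hd q; rewrite mulrDl mulrDr hc hd. Qed.

Lemma centralM c d : central c -> central d -> central (c * d).
Proof. by move=> hc hd q; rewrite -mulrA hd !mulrA hc. Qed.

Lemma mulrCC c x y : central c -> x * (c * y) = c * (x * y).
Proof. by move=> hc; rewrite !mulrA hc. Qed.

Hypothesis central_inv :
  forall c, central c -> c <> 0 -> exists2 d, central d & d * c = 1.

Lemma central_mul_eq0 c x : central c -> c * x = 0 -> c = 0 \/ x = 0.
Proof.
move=> hc cx; have [->|/eqP/(central_inv hc) [d _ dc]] := eqVneq c 0; first by left.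
by right; rewrite -(mul1r x) -dc -mulrA cx mulr0.
Qed.

(** Gaussian elimination: if the last generator occurs in no [f i], drop it along with the last
    vector; otherwise a pivot row [p] clears it from the other rows. *)
Lemma steinitz k (g : 'I_k -> Q) (f : 'I_k.+1 -> Q) (u : 'I_k.+1 -> 'I_k -> Q) :
  (forall i j, central (u i j)) -> (forall i, f i = \sum_j u i j * g j) ->
  exists c : 'I_k.+1 -> Q, [/\ forall i, central (c i),
    \sum_i c i * f i = 0 & exists i, c i <> 0].
Proof.
elim: k g f u => [|k IHk] g f u uC fE.
  exists (fun=> 1); split; first by move=> _; exact: central1.
    by rewrite big_ord1 fE big_ord0 mulr0.
  by exists ord0; apply/eqP; exact: oner_neq0.
have [/forallP u0|] := boolP [forall i, u i ord_max == 0].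
  have [i||c [cC c0 [i ci]]] := IHk (g \o widen_ord (leqnSn k))
    (f \o widen_ord (leqnSn k.+1))
    (fun i j => u (widen_ord (leqnSn k.+1) i) (widen_ord (leqnSn k) j)).
  - by move=> j; exact: uC.
  - by move=> i; rewrite /= fE big_ord_recr /= (eqP (u0 _)) mul0r addr0.
  exists (fun i => if unlift ord_max i is Some j then c j else 0); split.
  - by move=> j; case: unlift => // ; exact: central0.
  - rewrite big_ord_recr /= unlift_none mul0r addr0 -[RHS]c0.
    apply: eq_bigr => j _.
    have -> : widen_ord (leqnSn k.+1) j = lift ord_max j.
      by apply: val_inj; rewrite /= /bump leqNgt ltn_ord.
    rewrite liftK /=; congr (_ * f _); apply: val_inj => /=.
    by rewrite /bump leqNgt ltn_ord.
  - by exists (lift ord_max i); rewrite liftK.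
rewrite negb_forall => /existsP[p /eqP up].
have [d dC du] := central_inv (uC p ord_max) up.
pose v i := u (lift p i) ord_max * d.
have vC i : central (v i) by exact: centralM.
have [i j||c [cC c0 [i ci]]] := IHk (g \o widen_ord (leqnSn k))
    (fun i => f (lift p i) - v i * f p)
    (fun i j => u (lift p i) (widen_ord (leqnSn k) j)
                - v i * u p (widen_ord (leqnSn k) j)).
- by apply: centralD => //; apply: centralN; exact: centralM.
- move=> i; rewrite !fE !big_ord_recr /= mulrDr opprD addrACA.
  rewrite /v !mulrA -(mulrA _ d (u p ord_max)) du mulr1 subrr addr0 mulr_sumr -sumrB.
  by apply: eq_bigr => j _; rewrite mulrBl !mulrA.
(* The coefficient at [p] collects the multiples of [f p] subtracted from the other rows. *)
exists (fun i => if unlift p i is Some j then c j else - \sum_j c j * v j).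
have sC : central (- \sum_j c j * v j).
  apply: centralN; apply: big_ind => [|x y|j _]; first exact: central0.
    exact: centralD.
  exact: centralM.
split.
- by move=> j; case: unlift.
- rewrite (bigD1_ord p) //= unlift_none mulNr addrC mulr_suml -sumrB -[RHS]c0.
  by apply: eq_bigr => j _; rewrite liftK mulrBr [in RHS]mulrA.
- by exists (lift p i); rewrite liftK.
Qed.

End Center.

(** * Commutators in characteristic 2 *)

Section Commutator.
Variable Q : nzRingType.
Implicit Types x y z c : Q.

Definition comm x y := x * y - y * x.

Lemma commDl x y z : comm (x + y) z = comm x z + comm y z.
Proof. by rewrite /comm mulrDl mulrDr opprD addrACA. Qed.

Lemma commDr x y z : comm x (y + z) = comm x y + comm x z.
Proof. by rewrite /comm mulrDl mulrDr opprD addrACA. Qed.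

Lemma commCl c x : central c -> comm c x = 0.
Proof. by move=> hc; rewrite /comm hc subrr. Qed.

Lemma commCr c x : central c -> comm x c = 0.
Proof. by move=> hc; rewrite /comm hc subrr. Qed.

Lemma commZl c x y : central c -> comm (c * x) y = c * comm x y.
Proof. by move=> hc; rewrite /comm mulrBr (mulrCC _ _ hc) -mulrA. Qed.

Lemma commZr c x y : central c -> comm x (c * y) = c * comm x y.
Proof. by move=> hc; rewrite /comm mulrBr (mulrCC _ _ hc) -mulrA. Qed.

Lemma commxx x : comm x x = 0.
Proof. exact: subrr. Qed.

Lemma commMr x y z : comm x (y * z) = comm x y * z + y * comm x z.
Proof. by rewrite /comm mulrBl mulrBr !mulrA addrA subrK. Qed.

Lemma comm0r x : comm x 0 = 0.
Proof. by rewrite /comm mulr0 mul0r subrr. Qed.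

Hypothesis char2 : forall x, x + x = 0.

Lemma opp_char2 x : - x = x.
Proof. by apply/esym/eqP; rewrite -addr_eq0 char2. Qed.

Lemma commC x y : comm x y = comm y x.
Proof. by rewrite -(opp_char2 (comm x y)) opprB. Qed.

Lemma comm_comm x y : comm x (comm x y) = comm (x * x) y.
Proof.
rewrite /comm mulrBr mulrBl !mulrA !opp_char2 -addrA.
by rewrite (addrA (x * y * x)) char2 add0r.
Qed.

Lemma sqrD_char2 x y : (x + y) * (x + y) = x * x + y * y + comm x y.
Proof.
by rewrite /comm mulrDl !mulrDr opp_char2 (addrC (y * x)) addrACA.
Qed.

End Commutator.

(** * Prime algebras of dimension four *)

Section PrimeAlgebra.
Variables (Q : nzRingType) (A : set Q).
Local Notation C := (@central Q).
Hypothesis C_inv : forall c, C c -> c <> 0 -> exists2 d, C d & d * c = 1.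
Hypothesis A_sub : additive_subgroup A.
Hypothesis AM : forall x y, A x -> A y -> A (x * y).
Hypothesis AZ : forall c x, C c -> A x -> A (c * x).
Hypothesis A_prime :
  forall p q, (forall x, A x -> p * x * q = 0) -> p = 0 \/ q = 0.
(** Dimension at most four, in the form of dependence relations; [A] will be RC inside Q_s(R). *)
Hypothesis A_dep : forall f : 'I_5 -> Q, (forall i, A (f i)) ->
  exists c : 'I_5 -> Q, [/\ forall i, C (c i),
    \sum_i c i * f i = 0 & exists i, c i <> 0].

Let AB x y : A x -> A y -> A (x - y). Proof. exact: A_sub.2. Qed.
Let AD x y : A x -> A y -> A (x + y).
Proof.
by move=> Ax Ay; rewrite -(opprK y) -(sub0r y); do 2![apply: AB => //]; exact: A_sub.1.
Qed.

Lemma prime_neq0 p q : p <> 0 -> q <> 0 -> exists2 x, A x & p * x * q <> 0.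
Proof.
move=> p0 q0; apply: contrapT => no.
have [x Ax||] // := @A_prime p q.
by apply: contrapT => pxq; apply: no; exists x.
Qed.

Lemma dep5 x0 x1 x2 x3 x4 : A x0 -> A x1 -> A x2 -> A x3 -> A x4 ->
  exists c0 c1 c2 c3 c4, [/\ C c0, C c1, C c2, C c3 & C c4] /\
   [/\ c0 * x0 + c1 * x1 + c2 * x2 + c3 * x3 + c4 * x4 = 0 &
     ~ [/\ c0 = 0, c1 = 0, c2 = 0, c3 = 0 & c4 = 0]].
Proof.
move=> A0 A1 A2 A3 A4.
have [i|c [cC]] := @A_dep (nth 0 [:: x0; x1; x2; x3; x4]).
  by case: i => -[|[|[|[|[|i]]]]].
rewrite !big_ord_recr big_ord0 /= add0r => c0 [i ci].
do 5![eexists]; split; last split; [|exact: c0|]; first by split; exact: cC.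
case=> e0 e1 e2 e3 e4; apply: ci; case: i => -[|[|[|[|[|i]]]]] //= lt5.
- by rewrite -e0; congr c; apply: val_inj.
- by rewrite -e1; congr c; apply: val_inj.
- by rewrite -e2; congr c; apply: val_inj.
- by rewrite -e3; congr c; apply: val_inj.
- by rewrite -e4; congr c; apply: val_inj.
Qed.

(* j is the least index with a nonzero coefficient in a dependence relation    *)
(* between f 0, ..., f 4; solve that relation for f j.                         *)
Lemma chain_stops (f : nat -> Q) (m : nat -> nat -> Q) :
  (forall i, A (f i)) -> (forall i j, (i < j)%N -> f j = f i * m i j) ->
  exists (j : 'I_5) (c : 'I_5 -> Q), (forall i, C (c i)) /\
    f j = f j * \sum_(i < 5 | (j < i)%N) c i * m j i.
Proof.
move=> Af fm; have [c [cC c0 [k ck]]] := A_dep (fun i : 'I_5 => Af i).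
have [//|j cj jmin] := @arg_minnP _ k (fun i => c i != 0) (fun i => nat_of_ord i); first exact/eqP.
have [d dC dc] := C_inv (cC j) (elimN eqP cj).
exists j, (fun i => - (d * c i)); split; first by move=> i; apply/centralN/centralM.
have /eqP : d * \sum_(i < 5) c i * f i = 0 by rewrite c0 mulr0.
rewrite (bigD1 j) //= mulrDr mulrA dc mul1r addr_eq0 => /eqP fj; rewrite {1}fj.
rewrite mulr_sumr mulr_sumr -sumrN [RHS]big_mkcond [LHS]big_mkcond /=.
apply: eq_bigr => i _; case: (ltngtP j i) => [lt_ji|lt_ij|/val_inj->]; last by rewrite eqxx.
  rewrite ifT; last by rewrite neq_ltn lt_ji orbT.
  have dciC : C (- (d * c i)) by apply/centralN/centralM.
  by rewrite (mulrCC _ _ dciC) -fm // mulNr !mulrA.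
rewrite ifT; last by rewrite neq_ltn lt_ij.
have -> : c i = 0; last by rewrite mul0r mulr0 oppr0.
by apply/eqP; apply: contraTT lt_ij => /jmin; rewrite leqNgt.
Qed.

(** * A nonzero idempotent of A *)

Hypothesis A_neq0 : exists2 x, A x & x <> 0.

Lemma A_sum (I : Type) (r : seq I) (P : pred I) (F : I -> Q) :
  (forall i, P i -> A (F i)) -> A (\sum_(i <- r | P i) F i).
Proof. by move=> AF; elim/big_ind: _ => //; exact: A_sub.1. Qed.

Lemma A_exp x n : A x -> A (x ^+ n.+1).
Proof. by move=> Ax; elim: n => [|n IHn] //; rewrite exprS; exact: AM. Qed.

(* Apply chain_stops to a chain x, x a x, ... of nonzero elements, each a left *)
(* divisor of the next ones.                                                   *)
Lemma ex_local_unit : exists x s, [/\ A x, A s, x <> 0 & x * s = x].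
Proof.
have [x Ax x0] := A_neq0.
(* Primeness gives a with y a y nonzero; the value 0 is a dummy for y outside A or zero. *)
have /choice[g gP] (y : Q) : exists a, A y -> y <> 0 -> A a /\ y * a * y <> 0.
  have [[Ay y0]|no] := pselect (A y /\ y <> 0).
    by have [a Aa ya] := prime_neq0 y0 y0; exists a.
  by exists 0 => Ay y0; case: no.
pose f := fix f n := if n is n'.+1 then f n' * (g (f n') * f n') else x.
have fP n : A (f n) /\ f n <> 0.
  elim: n => [|n [Afn fn0]] //=; have [Ag gn0] := gP _ Afn fn0.
  by split; [do ![exact: AM|apply: AM]|rewrite mulrA].
have /choice[m mP] (ij : nat * nat) :
    exists m, (ij.1 < ij.2)%N -> f ij.2 = f ij.1 * m /\ A m.
  case: ij => i j /=; have [lt_ij|] := ltnP i j; last by exists 0.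
  suff [m fE] : exists m, f j = f i * m /\ A m by exists m.
  rewrite -(subnKC lt_ij); elim: (j - i.+1)%N => [|k [m [fE Am]]].
    rewrite addn0; exists (g (f i) * f i); split=> //.
    by apply: AM; [case: (gP _ (fP i).1 (fP i).2)|case: (fP i)].
  have [Afk fk0] := fP (i.+1 + k)%N.
  exists (m * (g (f (i.+1 + k)%N) * f (i.+1 + k)%N)).
  rewrite addnS mulrA -fE; split=> //.
  by apply: AM => //; apply: AM => //; case: (gP _ Afk fk0).
have [i|i j lt_ij|j [c [cC fE]]] := chain_stops (f := f) (m := fun i j => m (i, j)).
- exact: (fP i).1.
- exact: (mP (i, j) lt_ij).1.
exists (f j), (\sum_(i < 5 | (j < i)%N) c i * m (nat_of_ord j, nat_of_ord i)).
have [Afj fj0] := fP j; split=> //.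
by apply: A_sum => i lt_ji; apply: AZ => //; exact: (mP (nat_of_ord j, nat_of_ord i) lt_ji).2.
Qed.

(* A dependence between powers of the local unit s gives s^k = s^k h with      *)
(* h = s g, where g is a polynomial in s; then h^k is idempotent.              *)
Lemma ex_idempotent : exists e, [/\ A e, e <> 0 & e * e = e].
Proof.
have [x [s [Ax As x0 xs]]] := ex_local_unit.
have xsn n : x * s ^+ n = x.
  by elim: n => [|n IHn]; first exact: mulr1; rewrite exprS mulrA xs.
have [i|i j lt_ij|j [c [cC]]] :=
    chain_stops (f := fun i => s ^+ i.+1) (m := fun i j => s ^+ (j - i)).
- exact: A_exp.
- by rewrite -exprD addSn subnKC // ltnW.
set h := \sum_(_ < _ | _) _ => sh.
have Ah : A h.
  apply: A_sum => i lt_ji; apply: AZ => //.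
  by rewrite -(subnSK lt_ji); exact: A_exp.
pose g := \sum_(i < 5 | (j < i)%N) c i * s ^+ (i - j).-1.
have hE : h = s * g.
  rewrite mulr_sumr; apply: eq_bigr => i lt_ji.
  by rewrite mulrCC // -exprS prednK // subn_gt0.
have sg : GRing.comm s g.
  apply: commr_sum => i _; apply: commrM; last exact: commrX.
  by rewrite /GRing.comm cC.
have shn n : s ^+ j.+1 * h ^+ n = s ^+ j.+1.
  by elim: n => [|n IHn]; first exact: mulr1; rewrite (exprS h) mulrA -sh.
exists (h ^+ j.+1); split; first exact: A_exp.
(* x = x s^k = x s^k h^k for k = j + 1, so h^k cannot vanish. *)
- move=> h0; have := shn j.+1; rewrite h0 mulr0 => s0.
  by apply: x0; rewrite -(xsn j.+1) -s0 mulr0.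
- have sgk : s ^+ j.+1 * g ^+ j.+1 = g ^+ j.+1 * s ^+ j.+1.
    by apply/commr_sym/commrX/commr_sym/commrX.
  by rewrite {1 3}hE exprMn_comm // sgk -mulrA shn.
Qed.

(** * The unit of A *)

Hypothesis A_centralizer : forall q, (forall x, A x -> q * x = x * q) -> C q.

(** (y e - y) A x = 0 makes e a right identity too, so e lies in C; there e (e - 1) = 0 leaves only
    e = 1. *)
Lemma left_unit_eq1 e : A e -> e <> 0 -> (forall x, A x -> e * x = x) -> e = 1.
Proof.
move=> Ae e0 eL; have [x Ax x0] := A_neq0.
have eR y : A y -> y * e = y.
  move=> Ay; apply/subr0_eq; have [z Az|//|//] := @A_prime (y * e - y) x.
  by rewrite mulrBl -(mulrA y) eL // subrr mul0r.
have eC : C e by apply: A_centralizer => y Ay; rewrite eL ?eR.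
have [|//|/subr0_eq//] := central_mul_eq0 C_inv (x := e - 1) eC.
by rewrite mulrBr mulr1 eL // subrr.
Qed.

Lemma scale_eq0 c x : C c -> x <> 0 -> c * x = 0 -> c = 0.
Proof. by move=> hc x0 /(central_mul_eq0 C_inv hc)[]. Qed.

Lemma C_solve c x y : C c -> c <> 0 -> c * x = y -> exists2 d, C d & x = d * y.
Proof.
move=> hc /(C_inv hc)[d hd dc] <-; exists d => //.
by rewrite mulrA dc mul1r.
Qed.

(* The four Peirce components of A relative to e are nonzero, hence are the    *)
(* lines spanned by e, u, v and w; e plus a multiple of w is a left identity.  *)
Section Peirce.
Variable e : Q.
Hypotheses (Ae : A e) (e0 : e <> 0) (ee : e * e = e).
Variables u v w : Q.
Hypotheses (Au : A u) (Av : A v) (Aw : A w).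
Hypotheses (u0 : u <> 0) (v0 : v <> 0) (w0 : w <> 0).
Hypotheses (eu : e * u = u) (ue : u * e = 0) (ev : e * v = 0) (ve : v * e = v).
Hypotheses (ew : e * w = 0) (we : w * e = 0).

Let peirce_l c0 c1 c2 c3 : C c0 -> C c1 -> C c2 -> C c3 ->
  e * (c0 * e + c1 * u + c2 * v + c3 * w) = c0 * e + c1 * u.
Proof.
move=> h0 h1 h2 h3; rewrite !mulrDr (mulrCC _ _ h0) (mulrCC _ _ h1) (mulrCC _ _ h2).
by rewrite (mulrCC _ _ h3) ee eu ev ew !mulr0 !addr0.
Qed.

Let peirce_r c0 c1 c2 c3 :
  (c0 * e + c1 * u + c2 * v + c3 * w) * e = c0 * e + c2 * v.
Proof. by rewrite !mulrDl -!mulrA ee ue ve we !mulr0 !addr0. Qed.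

Let peirce_lr c0 c1 : c0 * e + c1 * u = 0 -> C c0 -> C c1 -> c0 = 0 /\ c1 = 0.
Proof.
move=> E h0 h1; have := congr1 (fun z => z * e) E.
rewrite mulrDl -!mulrA ee ue mulr0 addr0 mul0r => /(scale_eq0 h0 e0) c00.
by move: E; rewrite c00 mul0r add0r => /(scale_eq0 h1 u0) ->.
Qed.

(** Multiplying by e on either side separates the components, so e, u, v, w are independent and any
    dependence with x can be solved for x. *)
Lemma peirce_expand x : A x -> exists c0 c1 c2 c3,
  [/\ C c0, C c1, C c2 & C c3] /\ x = c0 * e + c1 * u + c2 * v + c3 * w.
Proof.
move=> Ax; have [c0 [c1 [c2 [c3 [c4 [[h0 h1 h2 h3 h4] [E nz]]]]]]] := dep5 Ae Au Av Aw Ax.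
have c4_neq0 : c4 <> 0.
  move=> c4E; apply: nz; move: E; rewrite {}c4E mul0r addr0 => E.
  have := congr1 (fun z => e * z) E; rewrite mulr0 peirce_l // => El.
  have [c00 c10] := peirce_lr El h0 h1.
  have := congr1 (fun z => z * e) E; rewrite mul0r peirce_r c00 mul0r add0r.
  move/(scale_eq0 h2 v0) => c20; move: E.
  by rewrite c00 c10 c20 !mul0r !add0r => /(scale_eq0 h3 w0) ->.
have [|d hd ->] := C_solve (x := x)
  (y := - (c0 * e + c1 * u + c2 * v + c3 * w)) h4 c4_neq0.
  by apply/eqP; rewrite -addr_eq0 addrC E.
exists (- (d * c0)), (- (d * c1)), (- (d * c2)), (- (d * c3)).
split; first by split; apply/centralN/centralM.
by rewrite mulrN !mulrDr !mulrA !opprD !mulNr.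
Qed.

(** w^2 = [cw] w and w v = [cv] v. Both scalars are nonzero by primeness and equal by associativity
    of w w v; hence e + w / [cw] is a left identity. *)
Lemma peirce_1 : A 1.
Proof.
have uM : w * u = 0 by rewrite -eu mulrA we mul0r.
have vv : v * v = 0 by rewrite -{1}ve -mulrA ev mulr0.
have vw : v * w = 0 by rewrite -ve -mulrA ew mulr0.
have [cw cwC wwE] : exists2 c, C c & w * w = c * w.
  have [c0 [c1 [c2 [c3 [[h0 h1 h2 h3] E]]]]] := peirce_expand (AM Aw Aw).
  have := congr1 (fun z => e * z) E; rewrite mulrA ew mul0r peirce_l // => /esym El.
  have [c00 c10] := peirce_lr El h0 h1.
  have := congr1 (fun z => z * e) E; rewrite -mulrA we mulr0 peirce_r c00 mul0r add0r.
  move=> /esym /(scale_eq0 h2 v0) c20; exists c3 => //.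
  by rewrite E c00 c10 c20 !mul0r !add0r.
have [cv cvC wvE] : exists2 c, C c & w * v = c * v.
  have [c0 [c1 [c2 [c3 [[h0 h1 h2 h3] E]]]]] := peirce_expand (AM Aw Av).
  have := congr1 (fun z => e * z) E; rewrite mulrA ew mul0r peirce_l // => /esym El.
  have [c00 c10] := peirce_lr El h0 h1.
  have := congr1 (fun z => z * e) E; rewrite -mulrA ve peirce_r c00 mul0r add0r.
  by exists c2.
have cw0 : cw <> 0.
  move=> cwE; have [x Ax] := prime_neq0 w0 w0; apply.
  have [c0 [c1 [c2 [c3 [[h0 h1 h2 h3] ->]]]]] := peirce_expand Ax.
  rewrite !mulrDr (mulrCC _ _ h0) (mulrCC _ _ h1) (mulrCC _ _ h2) (mulrCC _ _ h3).
  by rewrite we uM wwE cwE mul0r !mulr0 !add0r addr0 -mulrA -mulrA vw !mulr0.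
have cv0 : cv <> 0.
  move=> cvE; have [x Ax] := prime_neq0 w0 v0; apply.
  have [c0 [c1 [c2 [c3 [[h0 h1 h2 h3] ->]]]]] := peirce_expand Ax.
  rewrite !mulrDr (mulrCC _ _ h0) (mulrCC _ _ h1) (mulrCC _ _ h2) (mulrCC _ _ h3).
  by rewrite we uM wvE cvE mul0r !mulr0 !add0r wwE -!mulrA wvE cvE mul0r !mulr0.
have cvw : cv = cw.
  apply/subr0_eq; apply: (scale_eq0 _ v0); first exact/centralD/centralN.
  have [|//|//] := central_mul_eq0 C_inv (x := (cv - cw) * v) cvC.
  rewrite mulrBl mulrBr (mulrCC cv v cwC) -{2}wvE (mulrA cw) -wwE -mulrA wvE.
  by rewrite (mulrCC w v cvC) wvE subrr.
have [k kC kcw] := C_inv cwC cw0.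
have gL x : A x -> (e + k * w) * x = x.
  move=> Ax; have [c0 [c1 [c2 [c3 [[h0 h1 h2 h3] E]]]]] := peirce_expand Ax.
  rewrite mulrDl {1}E peirce_l // {1}E !mulrDr -!mulrA.
  rewrite (mulrCC w _ h0) (mulrCC w _ h1) (mulrCC w _ h2) (mulrCC w _ h3).
  rewrite we uM wvE wwE cvw !mulr0 !add0r.
  by rewrite !(mulrCC k _ h2) !(mulrCC k _ h3) !(mulrA k) kcw !mul1r addrA E.
have Ag : A (e + k * w) by apply: AD => //; exact: AZ.
by rewrite -(left_unit_eq1 Ag _ gL) // => g0; apply: e0; rewrite -(gL e Ae) g0 mul0r.
Qed.

End Peirce.

(** A one-sided identity e is already 1. Otherwise (1 - e) A and A (1 - e) contain nonzero [d] and
    [d'], and primeness makes the other three Peirce components nonzero. *)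
Lemma A1 : A 1.
Proof.
have [e [Ae e0 ee]] := ex_idempotent; have [q Aq q0] := A_neq0.
have [eL|] := pselect (forall x, A x -> e * x = x).
  by rewrite -(left_unit_eq1 Ae e0 eL).
move=> eNL; have [|] := pselect (forall x, A x -> x * e = x) => [eR|eNR].
  case: eNL => x Ax; apply/subr0_eq.
  have [z Az|//|//] := @A_prime q (e * x - x).
  by rewrite mulrBr -!mulrA (mulrA z e) eR // subrr.
have /existsNP[x /not_implyP[Ax ex]] := eNL.
have /existsNP[y /not_implyP[Ay ye]] := eNR.
pose d := x - e * x; pose d' := y - y * e.
have Ad : A d by apply: AB => //; exact: AM.
have Ad' : A d' by apply: AB => //; exact: AM.
have d0 : d <> 0 by move=> /subr0_eq /esym.
have d'0 : d' <> 0 by move=> /subr0_eq /esym.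
have ed : e * d = 0 by rewrite mulrBr mulrA ee subrr.
have d'e : d' * e = 0 by rewrite mulrBl -mulrA ee subrr.
have [a Aa u0] := prime_neq0 e0 d'0.
have [b Ab v0] := prime_neq0 d0 e0.
have [c Ac w0] := prime_neq0 d0 d'0.
apply: (@peirce_1 e Ae e0 ee (e * a * d') (d * b * e) (d * c * d')) => //.
- by do 2![apply: AM => //].
- by do 2![apply: AM => //].
- by do 2![apply: AM => //].
- by rewrite !mulrA ee.
- by rewrite -mulrA d'e mulr0.
- by rewrite !mulrA ed !mul0r.
- by rewrite -mulrA ee.
- by rewrite !mulrA ed !mul0r.
- by rewrite -mulrA d'e mulr0.
Qed.

(** * Quadratic elements in characteristic 2 *)

Hypothesis char2 : forall q : Q, q + q = 0.

Lemma A_comm x y : A x -> A y -> A (comm x y).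
Proof. by move=> Ax Ay; apply: AB; exact: AM. Qed.

Lemma noncentral_comm x : ~ C x -> exists2 y, A y & comm x y <> 0.
Proof.
move=> xC; apply: contrapT => no; apply: xC; apply: A_centralizer => y Ay.
by apply/subr0_eq; apply: contrapT => xy; apply: no; exists y.
Qed.

(* The dependences of 1, x, x^2, a, b show that [x, A] is at most a line.      *)
Lemma quadratic x : A x -> exists s m, [/\ C s, C m & x * x = s * x + m].
Proof.
move=> Ax; have [xC|xNC] := pselect (C x).
  by exists x, 0; split=> //; [exact: central0|rewrite addr0].
apply: contrapT => no.
have [a Aa xa] := noncentral_comm xNC.
have comm_prop b : A b -> exists2 c, C c & comm x b = c * comm x a.
  move=> Ab; have [c0 [c1 [c2 [c3 [c4 [[h0 h1 h2 h3 h4] [E nz]]]]]]] :=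
    dep5 A1 Ax (AM Ax Ax) Aa Ab.
  have E' : c3 * comm x a + c4 * comm x b = 0.
    have := congr1 (comm x) E; rewrite comm0r !commDr (commZr _ _ h0) (commZr _ _ h1).
    rewrite (commZr _ _ h2) (commZr _ _ h3) (commZr _ _ h4) commMr !commxx.
    by rewrite (commCr _ (@central1 Q)) !(mul0r, mulr0, addr0, add0r).
  (* If [c4] = 0 then [c3] = 0 too, and the remaining relation among 1, x, x^2 makes x central or
     quadratic, both excluded. *)
  have [c40|c4N] := pselect (c4 = 0).
    move: E'; rewrite c40 mul0r addr0 => /(scale_eq0 h3 xa) c30; case: no.
    move: E; rewrite c30 c40 !mul0r !addr0 mulr1 => E.
    have [c20|c2N] := pselect (c2 = 0).
      have [c10|c1N] := pselect (c1 = 0).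
        by case: nz; split=> //; move: E; rewrite c10 c20 !mul0r !addr0.
      case: xNC; have [|d dC ->] := C_solve (x := x) (y := - c0) h1 c1N.
        by apply/eqP; rewrite -addr_eq0 addrC; move: E; rewrite c20 mul0r addr0 => ->.
      exact/centralM/centralN.
    have [|d dC xx] := C_solve (x := x * x) (y := - (c0 + c1 * x)) h2 c2N.
      by apply/eqP; rewrite -addr_eq0 addrC E.
    exists (- (d * c1)), (- (d * c0)); split; try exact/centralN/centralM.
    by rewrite xx mulrN mulrDr opprD mulNr mulrA addrC.
  have [|d dC ->] := C_solve (x := comm x b) (y := - (c3 * comm x a)) h4 c4N.
    by apply/eqP; rewrite -addr_eq0 addrC E'.
  exists (- (d * c3)); first exact/centralN/centralM.
  by rewrite mulrN mulNr mulrA.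
(* [s] is the eigenvalue of ad x on the line [x, A]; thus (ad x)^2 = s ad x on A. *)
have [s sC xu] := comm_prop _ (A_comm Ax Aa).
apply: no; exists s, (x * x - s * x); split=> //; last by rewrite addrC subrK.
apply: A_centralizer => b Ab; apply/subr0_eq.
change (comm (x * x + - (s * x)) b = 0).
rewrite opp_char2 // commDl -comm_comm // commZl //.
have [r rC ->] := comm_prop b Ab.
by rewrite commZr // xu (mulrCC _ _ sC) char2.
Qed.

(* [x, x y] = x [x, y], where [x, y] is invertible in C if nonzero.            *)
Lemma comm_central x : A x -> (forall y, A y -> C (comm x y)) -> C x.
Proof.
move=> Ax xC; apply: contrapT => xNC.
have [y Ay xy] := noncentral_comm xNC; apply: xNC.
have := xC _ (AM Ax Ay); rewrite commMr commxx mul0r add0r => xcC.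
have [|d dC ->] := C_solve (x := x) (y := x * comm x y) (xC y Ay) xy.
  by rewrite (xC y Ay).
exact: centralM.
Qed.

Hypothesis A_noncomm : exists x y, [/\ A x, A y & comm x y <> 0].

(** If all squares were central, so would be [a, y] = (a + y)^2 - a^2 - y^2, against
    noncommutativity. So some x0^2 = s x0 + m has s nonzero, and x = x0 / s works. *)
Lemma ex_separable : exists x m, [/\ A x, ~ C x, C m & x * x = x + m].
Proof.
have [x0 Ax0 x0x0] : exists2 x, A x & ~ C (x * x).
  apply: contrapT => no.
  have sqC x : A x -> C (x * x) by move=> Ax; apply: contrapT => xx; apply: no; exists x.
  have [a [b [Aa Ab ab]]] := A_noncomm; apply: ab; apply/commCl/comm_central => // y Ay.
  have -> : comm a y = (a + y) * (a + y) - (a * a + y * y).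
    by rewrite sqrD_char2 // addrC addKr.
  by apply/centralD/centralN/centralD; apply: sqC => //; exact: AD.
have [s [m [sC mC E]]] := quadratic Ax0.
have s0 : s <> 0 by move=> s0; apply: x0x0; rewrite E s0 mul0r add0r.
have [d dC ds] := C_inv sC s0.
exists (d * x0), (d * d * m); split.
- exact: AZ.
- move=> dxC; apply: x0x0; have -> : x0 = s * (d * x0) by rewrite mulrA sC ds mul1r.
  by apply: centralM; exact: centralM.
- by do 2![apply: centralM => //].
- rewrite -mulrA (mulrCC x0 x0 dC) E !mulrDr !mulrA; congr (_ + _).
  by rewrite -(mulrA d) ds mulr1.
Qed.

(** * The reduced trace attached to a separable element *)

Section Separable.
Variables x m : Q.
Hypotheses (Ax : A x) (xNC : ~ C x) (mC : C m) (xx : x * x = x + m).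

(* The 1-eigenspace of ad x in A; the 0-eigenspace is C + C x by even_span.   *)
Definition odd_part : set Q := [set z | A z /\ comm x z = z].
Local Notation I := odd_part.

Lemma odd0 : I 0.
Proof. by split; [exact: A_sub.1|exact: comm0r]. Qed.

Lemma oddD y z : I y -> I z -> I (y + z).
Proof. by move=> [Ay xy] [Az xz]; split; [exact: AD|rewrite commDr xy xz]. Qed.

Lemma oddZ c z : C c -> I z -> I (c * z).
Proof. by move=> hc [Az xz]; split; [exact: AZ|rewrite commZr // xz]. Qed.

(** (ad x)^2 = ad (x^2) = ad (x + m) = ad x, so ad x is a projection. *)
Lemma odd_comm a : A a -> I (comm x a).
Proof.
move=> Aa; split; first exact: A_comm.
by rewrite comm_comm // xx commDl (commCl _ mC) addr0.
Qed.

Lemma odd_mull k z : A k -> comm x k = 0 -> I z -> I (k * z).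
Proof.
by move=> Ak xk [Az xz]; split; [exact: AM|rewrite commMr xk mul0r add0r xz].
Qed.

(** The derivation ad x sends z^2 to 2 z^2 = 0, but also sends s z + n to s z; so z^2 = n. *)
Lemma odd_sqr z : I z -> C (z * z).
Proof.
move=> [Az xz]; have [s [n [sC nC zz]]] := quadratic Az.
have := commMr x z z; rewrite xz char2 zz commDr (commZr _ _ sC) xz (commCr _ nC).
by rewrite addr0 => ->; rewrite add0r.
Qed.

Lemma odd_comm_central y z : I y -> I z -> C (comm y z).
Proof.
move=> Iy Iz; have -> : comm y z = (y + z) * (y + z) - (y * y + z * z).
  by rewrite sqrD_char2 // addrC addKr.
by apply/centralD/centralN/centralD; apply: odd_sqr => //; exact: oddD.
Qed.

Lemma even_odd a : A a -> exists k z, [/\ A k, comm x k = 0, I z & a = k + z].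
Proof.
move=> Aa; exists (a - comm x a), (comm x a).
have Ia := odd_comm Aa; split=> //; last by rewrite subrK.
  by apply: AB => //; case: Ia.
by rewrite opp_char2 // commDr (proj2 Ia) char2.
Qed.

(* If all squares of odd elements vanish, odd elements commute, so y A y = 0   *)
(* for every odd y.                                                            *)
Lemma ex_odd_invertible : exists2 y, I y & y * y <> 0.
Proof.
apply: contrapT => no.
have sq0 y : I y -> y * y = 0 by move=> Iy; apply: contrapT => yy; apply: no; exists y.
have [a Aa] := noncentral_comm xNC; apply.
move: (comm x a) (odd_comm Aa) => y Iy.
have [b Ab|//|//] := @A_prime y y.
have [k [z [Ak xk Iz ->]]] := even_odd Ab.
have commute0 t : I t -> y * t * y = 0.
  move=> It; have := sqrD_char2 char2 y t.
  rewrite !sq0 ?addr0 ?add0r //; last exact: oddD.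
  by move=> /esym/subr0_eq yt; rewrite yt -mulrA (sq0 y Iy) mulr0.
rewrite mulrDr mulrDl (commute0 z Iz) addr0.
(* For k even, k y is odd and commutes with y, whence y k y = k y^2 = 0. *)
have Iky := odd_mull Ak xk Iy.
have := sqrD_char2 char2 y (k * y); rewrite !sq0 ?addr0 ?add0r //; last exact: oddD.
by move=> /esym/subr0_eq; rewrite mulrA => ->; rewrite -mulrA (sq0 y Iy) mulr0.
Qed.

Lemma indep_1x c0 c1 : C c0 -> C c1 -> c0 + c1 * x = 0 -> c0 = 0 /\ c1 = 0.
Proof.
move=> h0 h1 E; have [c10|c1N] := pselect (c1 = 0).
  by move: E; rewrite c10 mul0r addr0.
case: xNC; have [|d dC ->] := C_solve (x := x) (y := - c0) h1 c1N.
  by apply/eqP; rewrite -addr_eq0 addrC E.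
exact/centralM/centralN.
Qed.

(** In a dependence between 1, x, y, x y, k, bracketing with x keeps only the y and x y terms. Since
    y^2 is an invertible scalar, their coefficients vanish. *)
Lemma even_span k : A k -> comm x k = 0 ->
  exists c0 c1, [/\ C c0, C c1 & k = c0 + c1 * x].
Proof.
move=> Ak xk; have [y Iy yy0] := ex_odd_invertible.
have Ixy := odd_mull Ax (commxx x) Iy.
have [c0 [c1 [c2 [c3 [c4 [[h0 h1 h2 h3 h4] [E nz]]]]]]] :=
  dep5 A1 Ax (proj1 Iy) (proj1 Ixy) Ak.
have E' : c2 * y + c3 * (x * y) = 0.
  have := congr1 (comm x) E; rewrite comm0r !commDr (commZr _ _ h0) (commZr _ _ h1).
  rewrite (commZr _ _ h2) (commZr _ _ h3) (commZr _ _ h4) (proj2 Iy) (proj2 Ixy) xk.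
  by rewrite (commCr _ (@central1 Q)) commxx !(mulr0, addr0, add0r).
have [c20 c30] : c2 = 0 /\ c3 = 0.
  apply: indep_1x => //; have := congr1 (fun z => z * y) E'.
  rewrite mul0r (mulrA c3) -mulrDl -mulrA -(odd_sqr Iy).
  by move=> /(central_mul_eq0 C_inv (odd_sqr Iy)) [].
move: E; rewrite c20 c30 !mul0r !addr0 mulr1 => E.
have c4N : c4 <> 0.
  move=> c40; move: E; rewrite c40 mul0r addr0 => /(indep_1x h0 h1) [c00 c10].
  exact: nz.
have [|d dC ->] := C_solve (x := k) (y := c0 + c1 * x) h4 c4N.
  by rewrite -(opp_char2 char2 (_ + _)); apply/eqP; rewrite -addr_eq0 addrC E.
exists (d * c0), (d * c1); split; try exact: centralM.
by rewrite mulrDr mulrA.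
Qed.

Lemma decomp a : A a ->
  exists c, C c /\ exists d z, [/\ C d, I z & a = d + c * x + z].
Proof.
move=> Aa; have [k [z [Ak xk Iz ->]]] := even_odd Aa.
have [c0 [c1 [h0 h1 ->]]] := even_span Ak xk.
by exists c1; split=> //; exists c0, z.
Qed.

Lemma decomp_uniq c d z c' d' z' : C c -> C d -> I z -> C c' -> C d' -> I z' ->
  d + c * x + z = d' + c' * x + z' -> c = c'.
Proof.
move=> hc hd [_ xz] hc' hd' [_ xz'] E.
have := congr1 (comm x) E; rewrite !commDr (commZr _ _ hc) (commZr _ _ hc').
rewrite (commCr _ hd) (commCr _ hd') commxx !mulr0 !add0r xz xz' => zz'.
move: E; rewrite zz' => /addIr E.
have [|||_ /subr0_eq] // := @indep_1x (d - d') (c - c').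
- exact/centralD/centralN.
- exact/centralD/centralN.
- by rewrite mulrBl addrACA E -opprD subrr.
Qed.

(** For A = RC this is convertible with [set_bracket (RC R) (RC R)]. *)
Definition brackets : set Q :=
  additive_span [set z | exists a b, [/\ A a, A b & z = comm a b]].

(** z = [x, z], and c = [c y^-2 y, x y] for an odd y with y^2 nonzero, because [y, x y] = y^2. *)
Lemma brackets_odd z c : I z -> C c -> brackets (c + z).
Proof.
move=> Iz hc G [G0 GB] sG.
have GD u v : G u -> G v -> G (u + v).
  by move=> Gu Gv; rewrite -(opprK v) -(sub0r v); exact: GB _ _ Gu (GB _ _ G0 Gv).
have [y Iy yy0] := ex_odd_invertible.
have Ixy := odd_mull Ax (commxx x) Iy.
have [d dC dyy] := C_inv (odd_sqr Iy) yy0.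
apply: GD; last by rewrite -(proj2 Iz); apply: sG; exists x, z; split=> //; case: Iz.
apply: sG; exists (c * d * y), (x * y); split; [|by case: Ixy|].
  by apply: AZ; [exact: centralM|case: Iy].
rewrite commZl; last exact: centralM.
by rewrite commMr commxx mulr0 addr0 (commC char2) (proj2 Iy) -mulrA dyy mulr1.
Qed.

(** t(a) is the coefficient of x in [decomp]. Brackets of odd parts are central, and the
    x-coefficient 2 t(a) t(b) of t(a) b + t(b) a vanishes. *)
Lemma ex_trace : exists t : Q -> Q, [/\
  forall a, A a -> C (t a),
  forall a b, A a -> A b -> C (comm a b - (t a * b + t b * a)) &
  forall a, A a -> (t a = 0 <-> brackets a)].
Proof.
have /choice[t tP] (a : Q) : exists c, A a ->
    C c /\ exists d z, [/\ C d, I z & a = d + c * x + z].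
  by have [/decomp[c hc]|] := pselect (A a); [exists c|exists 0].
exists t.
have comm_decomp a b : A a -> A b -> exists c z z', [/\ C c, I z, I z' &
    [/\ exists d, C d /\ a = d + t a * x + z,
      exists d, C d /\ b = d + t b * x + z' &
      comm a b = c + (t a * z' + t b * z)]].
  move=> /tP[ta [d [z [hd Iz aE]]]] /tP[tb [d' [z' [hd' Iz' bE]]]].
  exists (comm z z'), z, z'; split=> //; first exact: odd_comm_central.
  split; [by exists d|by exists d'|].
  rewrite {1}aE {1}bE !commDl !commDr !(commCl _ hd) !(commCr _ hd').
  rewrite !(commZl _ _ ta) !(commZr _ _ tb) commxx (proj2 Iz') (commC char2 z x).
  by rewrite (proj2 Iz) !(mulr0, add0r) [LHS]addrA [LHS]addrC.
have trE a c d z : A a -> C c -> C d -> I z -> a = d + c * x + z -> t a = c.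
  move=> /tP[ta [d' [z' [hd' Iz' E]]]] hc hd Iz.
  by rewrite {1}E => /(decomp_uniq ta hd' Iz' hc hd Iz).
split=> [a /tP[]//|a b Aa Ab|a Aa].
  have [ta _] := tP a Aa; have [tb _] := tP b Ab.
  have [c [z [z' [hc Iz Iz' [[d [hd aE]] [d' [hd' bE]] ->]]]]] := comm_decomp a b Aa Ab.
  have -> : t a * b + t b * a = (t a * d' + t b * d) + (t a * z' + t b * z).
    rewrite {1}bE {2}aE !mulrDr (mulrCC (t b) x ta) [LHS]addrACA; congr (_ + _).
    by rewrite addrACA char2 addr0.
  rewrite opprD addrACA subrr addr0; apply/centralD/centralN/centralD => //; exact: centralM.
split=> [ta0|].
  have [_ [d [z [hd Iz ->]]]] := tP a Aa.
  by rewrite ta0 mul0r addr0; exact: brackets_odd.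
(* C plus the odd part is a subgroup containing every commutator, and t vanishes on it. *)
pose G : set Q := [set q | exists d z, [/\ C d, I z & q = d + z]].
move=> /(_ G) [||d [z [hd Iz E]]].
- split; first by exists 0, 0; split; [exact: central0|exact: odd0|rewrite addr0].
  move=> _ _ [d [z [hd Iz ->]]] [d' [z' [hd' Iz' ->]]]; rewrite opp_char2 // addrACA.
  by exists (d + d'), (z + z'); split=> //; [exact: centralD|exact: oddD].
- move=> _ [p [q [Ap Aq ->]]].
  have [c [z [z' [hc Iz Iz' [_ _ ->]]]]] := comm_decomp p q Ap Aq.
  exists c, (t p * z' + t q * z); split=> //.
  by apply: oddD; apply: oddZ => //; [case: (tP p Ap)|case: (tP q Aq)].
- by apply: (trE a 0 d z) => //; [exact: central0|rewrite mul0r addr0].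
Qed.

End Separable.

Lemma trace_form : exists t : Q -> Q, [/\
  forall a, A a -> C (t a),
  forall a b, A a -> A b -> C (comm a b - (t a * b + t b * a)),
  forall a, A a -> (t a = 0 <-> brackets a) &
  forall c, C c -> t c = 0].
Proof.
have [x [m [Ax xNC mC xx]]] := ex_separable.
have [t [tC tcomm tb]] := ex_trace Ax xNC mC xx.
exists t; split=> // c hc; apply/tb; first by rewrite -(mulr1 c); apply: AZ => //; exact: A1.
by rewrite -(addr0 c); apply: (brackets_odd Ax xNC mC xx) => //; exact: odd0.
Qed.

End PrimeAlgebra.

(** * The Martindale quotient ring and RC *)

Section MartindaleQuotients.
Variable R : primeRngType.
Local Notation Q := (Qs R).
Local Notation C := (@central Q).
Implicit Types (I : set R) (q : Q).

Lemma to_Qs0 : to_Qs (0 : R) = 0.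
Proof. by apply: (addrI (to_Qs (0 : R))); rewrite -to_QsD !addr0. Qed.

Lemma to_QsN (r : R) : to_Qs (- r) = - to_Qs r.
Proof. by apply: (addrI (to_Qs r)); rewrite -to_QsD !subrr to_Qs0. Qed.

Lemma to_QsB (r s : R) : to_Qs (r - s) = to_Qs r - to_Qs s.
Proof. by rewrite to_QsD to_QsN. Qed.

(** Once q kills I from the left, balancedness gives (x q) r z = x (q r z) = 0, so primeness kills
    the right action as well. *)
Lemma Qs_left_faithful I q : nonzero_ideal I ->
  (forall x, I x -> q * to_Qs x = 0) -> q = 0.
Proof.
elim/quotW: q => p hI pI0.
have hK := nonzero_ideal_setI hI (bp_ideal p).
have l0 x : I x -> bp_dom p x -> bp_l p x = 0.
  move=> Ix px; apply: to_Qs_inj; rewrite to_Qs0 -(pI0 x Ix).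
  exact: esym (Qs_mul_to_Qs px).
apply: (@Qs_eq R p (bp_zero R) _ hK); split=> [x []|//|x [Ix px]] //=.
split; first exact: l0.
have [[_ KM] [z [Kz z0]]] := hK.
have [r||] // := @rng_prime R (bp_r p x) z.
have [[Irz prz] _] := KM r z Kz.
by rewrite -rmulA -bp_lr // l0 // rmul0.
Qed.

Lemma Qs_right_faithful I q : nonzero_ideal I ->
  (forall x, I x -> to_Qs x * q = 0) -> q = 0.
Proof.
elim/quotW: q => p hI pI0.
have hK := nonzero_ideal_setI hI (bp_ideal p).
have r0 x : I x -> bp_dom p x -> bp_r p x = 0.
  move=> Ix px; apply: to_Qs_inj; rewrite to_Qs0 -(pI0 x Ix).
  exact: esym (to_Qs_mul_Qs px).
apply: (@Qs_eq R p (bp_zero R) _ hK); split=> [x []|//|x [Ix px]] //=.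
split; last exact: r0.
have [[_ KM] [z [Kz z0]]] := hK.
have [r||] // := @rng_prime R z (bp_l p x).
have [_ [Izr pzr]] := KM r z Kz.
by rewrite bp_lr // r0 // rmul_0.
Qed.

Lemma Qs_denominators q : exists I, nonzero_ideal I /\ forall x, I x ->
  exists r s, q * to_Qs x = to_Qs r /\ to_Qs x * q = to_Qs s.
Proof.
elim/quotW: q => p; exists (bp_dom p); split; first exact: bp_ideal.
move=> x px; exists (bp_l p x), (bp_r p x).
by split; [exact: Qs_mul_to_Qs|exact: to_Qs_mul_Qs].
Qed.

(** Denominators bring x p and q y into R, where primeness applies. *)
Lemma Qs_prime (p q : Q) :
  (forall r : R, p * to_Qs r * q = 0) -> p = 0 \/ q = 0.
Proof.
move=> pq; have [I [hI pI]] := Qs_denominators p.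
have [J [hJ qJ]] := Qs_denominators q.
apply: contrapT => /not_orP[p0 q0]; apply: q0.
apply: (Qs_left_faithful hJ) => y Jy; have [s [_ [qy _]]] := qJ y Jy.
apply: contrapT => s0; apply: p0; apply: (Qs_right_faithful hI) => x Ix.
have [_ [r [_ xp]]] := pI x Ix.
have [u|r00|s00] := @rng_prime R r s; [|by rewrite xp r00 to_Qs0|].
  apply: to_Qs_inj; rewrite to_Qs0 !to_QsM -xp -qy.
  change (to_Qs x * p * to_Qs u * (q * to_Qs y) = 0).
  by rewrite -!mulrA (mulrA p) (mulrA _ q) pq mul0r mulr0.
by case: s0; rewrite qy s00 to_Qs0.
Qed.

(** For a denominator x of q', both x and q' x lie in R and commute with q, so (q q' - q' q) x =
    0. *)
Lemma Qs_centralizer q : (forall r : R, q * to_Qs r = to_Qs r * q) -> C q.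
Proof.
move=> qR q'; have [I [hI q'I]] := Qs_denominators q'.
apply/subr0_eq/(Qs_left_faithful hI) => x Ix; have [r [_ [q'x _]]] := q'I x Ix.
by rewrite mulrBl -!mulrA qR (mulrA q') q'x qR subrr.
Qed.

(** Multiplication by c is injective on R, so c x |-> x is well defined on the ideal J = c I. As c
    is central, this one map serves as both actions of a balanced pair. *)
Lemma Qs_central_inv c : C c -> c <> 0 -> exists2 d, C d & d * c = 1.
Proof.
move=> hc c0; have [I [hI cI]] := Qs_denominators c.
have c_inj x y : c * to_Qs x = c * to_Qs y -> x = y.
  move=> cxy; have [|//|xy] := @Qs_prime c (to_Qs (x - y)).
    by move=> r; rewrite hc -mulrA to_QsB mulrBr cxy subrr mulr0.
  by apply/subr0_eq/to_Qs_inj; rewrite to_Qs0.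
pose J : set R := [set y | exists x, I x /\ c * to_Qs x = to_Qs y].
have hJ : nonzero_ideal J.
  have [[[I0 IB] IM] [z [Iz z0]]] := hI; split; [split; [split|]|].
  - by exists 0; rewrite to_Qs0 mulr0.
  - move=> x' y' [x [Ix cx]] [y [Iy cy]]; exists (x - y).
    by rewrite !to_QsB mulrBr cx cy; split=> //; exact: IB.
  - move=> r y [x [Ix cx]]; have [Irx Ixr] := IM r x Ix; split.
      exists (r ** x); split=> //; rewrite !to_QsM -cx.
      by change (c * (to_Qs r * to_Qs x) = to_Qs r * (c * to_Qs x)); rewrite !mulrA hc.
    exists (x ** r); split=> //; rewrite !to_QsM -cx.
    by change (c * (to_Qs x * to_Qs r) = c * to_Qs x * to_Qs r); rewrite mulrA.
  - have [r [_ [cz _]]] := cI z Iz; exists r; split; first by exists z.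
    move=> r0; apply: z0; apply: c_inj; rewrite cz r0 !to_Qs0.
    by rewrite mulr0.
have /choice[f fP] (y : R) : exists x, J y -> I x /\ c * to_Qs x = to_Qs y.
  by have [[x]|] := pselect (J y); [exists x|exists 0].
have [hJ' _] := hJ; have [JJ JM] := hJ'.
have fD x y : J x -> J y -> f (x + y) = f x + f y.
  move=> Jx Jy; apply: c_inj; rewrite (proj2 (fP _ (subgroupD JJ Jx Jy))).
  by rewrite !to_QsD mulrDr (proj2 (fP _ Jx)) (proj2 (fP _ Jy)).
have fMr x r : J x -> f (x ** r) = f x ** r.
  move=> Jx; apply: c_inj; rewrite (proj2 (fP _ (proj2 (JM r x Jx)))) !to_QsM.
  by rewrite -(proj2 (fP _ Jx)); exact: esym (mulrA _ _ _).
have fMl r x : J x -> f (r ** x) = r ** f x.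
  move=> Jx; apply: c_inj; rewrite (proj2 (fP _ (proj1 (JM r x Jx)))) !to_QsM.
  rewrite -(proj2 (fP _ Jx)).
  by change (to_Qs r * (c * to_Qs (f x)) = c * (to_Qs r * to_Qs (f x))); rewrite !mulrA hc.
have fM x y : J x -> J y -> x ** f y = f x ** y.
  by move=> Jx Jy; rewrite -fMl // fMr.
pose d : Q := \pi_Q (BalancedPair hJ fD fD fMr fMl fM).
have dc : d * c = 1.
  apply/subr0_eq/(Qs_left_faithful hI) => x Ix.
  have [r [_ [cx _]]] := cI x Ix; have Jr : J r by exists x.
  rewrite mulrBl mul1r -mulrA cx; apply/eqP; rewrite subr_eq0; apply/eqP.
  rewrite -[LHS]/(d ** to_Qs r) (@Qs_mul_to_Qs R (BalancedPair hJ fD fD fMr fMl fM)) //=.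
  congr to_Qs; apply: c_inj; by rewrite (proj2 (fP _ Jr)) cx.
exists d => // q; rewrite -[LHS]mulr1 -dc.
by rewrite -hc -mulrA (mulrA q) -hc !mulrA dc mul1r.
Qed.

Lemma Qs_char2 : (forall x : R, x *+ 2 = 0) -> forall q, q + q = 0.
Proof.
move=> R2 q; apply: (Qs_left_faithful (nonzero_ideal_setT R)) => x _.
by rewrite mulrDl -mulrDr -to_QsD -mulr2n R2 to_Qs0 mulr0.
Qed.

Lemma RC_sub : additive_subgroup (RC R).
Proof. exact: additive_span_subgroup. Qed.

Lemma RC_to_Qs (r : R) : RC R (to_Qs r).
Proof.
apply: sub_additive_span; exists (to_Qs r), 1.
by split; [exists r|exact: central1|exact: esym (mulr1 _)].
Qed.

Lemma RC_ind (L : set R) (P : set Q) : additive_subgroup P ->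
  (forall c r, C c -> L r -> P (c * to_Qs r)) -> central_closure L `<=` P.
Proof.
move=> hP PC q; apply=> // _ [_ [c [[r Lr <-] hc ->]]].
have -> : to_Qs r ** c = c * to_Qs r by exact: esym (hc _).
exact: PC.
Qed.

Lemma RC_Z c q : C c -> RC R q -> RC R (c * q).
Proof.
move=> hc; suff /(_ q) : RC R `<=` [set q | RC R (c * q)] by [].
apply: RC_ind => [|d r hd _] /=.
  split=> [|x y cx cy] /=; first by rewrite mulr0; exact: RC_sub.1.
  by rewrite mulrBr; exact: RC_sub.2.
rewrite mulrA (centralM hc hd); apply: sub_additive_span.
by exists (to_Qs r), (c * d); split=> //; exact: centralM.
Qed.

Lemma RC_M p q : RC R p -> RC R q -> RC R (p * q).
Proof.
move=> hp hq; suff /(_ p hp) : RC R `<=` [set p | RC R (p * q)] by [].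
apply: RC_ind => [|d r hd _] /=.
  split=> [|x y cx cy] /=; first by rewrite mul0r; exact: RC_sub.1.
  by rewrite mulrBl; exact: RC_sub.2.
rewrite -mulrA; apply: RC_Z => //.
suff /(_ q hq) : RC R `<=` [set q | RC R (to_Qs r * q)] by [].
apply: RC_ind => [|c s hc _] /=.
  split=> [|x y cx cy] /=; first by rewrite mulr0; exact: RC_sub.1.
  by rewrite mulrBr; exact: RC_sub.2.
by rewrite mulrCC //; apply: RC_Z => //; rewrite -[_ * _]to_QsM; exact: RC_to_Qs.
Qed.

Lemma RC_prime p q : (forall x, RC R x -> p * x * q = 0) -> p = 0 \/ q = 0.
Proof. by move=> pq; apply: Qs_prime => r; apply: pq; exact: RC_to_Qs. Qed.

Lemma RC_centralizer q : (forall x, RC R x -> q * x = x * q) -> C q.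
Proof. by move=> qRC; apply: Qs_centralizer => r; apply: qRC; exact: RC_to_Qs. Qed.

Lemma RC_dep : has_C_dim (RC R) 4 -> forall f : 'I_5 -> Q, (forall i, RC R (f i)) ->
  exists c : 'I_5 -> Q, [/\ forall i, C (c i),
    \sum_i c i * f i = 0 & exists i, c i <> 0].
Proof.
move=> [b [_ bP]] f fRC.
have /choice[u uP] (i : 'I_5) : exists u : {ffun 'I_4 -> Q},
    (forall j, C (u j)) /\ f i = \sum_j u j * b j.
  by have [u [hu _]] := bP _ (fRC i); exists u.
apply: (steinitz Qs_central_inv (g := b) (u := u)) => i; [exact: (uP i).1|exact: (uP i).2].
Qed.

Lemma RC_neq0 : exists2 x, RC R x & x <> 0.
Proof.
have [x x0] := @rng_nontrivial R; exists (to_Qs x); first exact: RC_to_Qs.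
by rewrite -to_Qs0 => /to_Qs_inj.
Qed.

Lemma to_Qs_bracket (r s : R) : to_Qs (bracket r s) = comm (to_Qs r) (to_Qs s).
Proof. by rewrite to_QsB !to_QsM. Qed.

Lemma to_Qs_center (r : R) : rng_center R r <-> C (to_Qs r).
Proof.
split=> [rC|rC s]; last by apply: to_Qs_inj; rewrite !to_QsM; exact: rC.
by apply: Qs_centralizer => s; have := congr1 (@to_Qs R) (rC s); rewrite !to_QsM.
Qed.

Lemma to_Qs_iter (s : seq R) x :
  to_Qs (foldr (@bracket R) x s) = foldr (@comm Q) (to_Qs x) (map (@to_Qs R) s).
Proof. by elim: s => //= r s <-; rewrite to_Qs_bracket. Qed.

End MartindaleQuotients.

(** * Iterated commutators *)

Section TraceForm.
Variables (Q : nzRingType) (A : set Q) (t : Q -> Q).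
Local Notation C := (@central Q).
Hypothesis C_inv : forall c, C c -> c <> 0 -> exists2 d, C d & d * c = 1.
Hypothesis tC : forall a, A a -> C (t a).
Hypothesis t_comm : forall a b, A a -> A b -> C (comm a b - (t a * b + t b * a)).

Lemma prod_trace_central (s : seq Q) : {in s, forall x, A x} ->
  C (\prod_(x <- s) t x).
Proof.
move=> As; rewrite big_seq; apply: big_ind => [|x y|x xs]; first exact: central1.
  exact: centralM.
exact/tC/As.
Qed.

Lemma prod_trace_eq0 (s : seq Q) : {in s, forall x, A x} ->
  \prod_(x <- s) t x = 0 <-> exists2 x, x \in s & t x = 0.
Proof.
elim: s => [|a s IHs] As.
  by rewrite big_nil; split=> [/eqP|[x]//]; rewrite oner_eq0.
have As' x : x \in s -> A x by move=> xs; apply: As; rewrite inE xs orbT.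
have Aa : A a by apply: As; exact: mem_head.
rewrite big_cons; split=> [/(central_mul_eq0 C_inv (tC Aa))[ta|/(IHs As')[x xs tx]]|].
- by exists a => //; exact: mem_head.
- by exists x => //; rewrite inE xs orbT.
- case=> x; rewrite inE => /predU1P[-> ->|xs tx]; first by rewrite mul0r.
  by rewrite (proj2 (IHs As')) ?mulr0 //; exists x.
Qed.

(** Modulo C, [a, w] = t(a) w. The error f - k w of the inner bracket is central, so bracketing with
    a removes it. *)
Lemma iter_comm_trace (s : seq Q) w : {in s, forall x, A x} -> A w -> t w = 0 ->
  C (foldr (@comm Q) w s - (\prod_(x <- s) t x) * w).
Proof.
move=> + Aw tw; elim: s => [|a s IHs] As /=.
  by rewrite big_nil mul1r subrr; exact: central0.
have As' x : x \in s -> A x by move=> xs; apply: As; rewrite inE xs orbT.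
have Aa : A a by apply: As; exact: mem_head.
have kC := prod_trace_central As'; move: (IHs As') kC.
rewrite big_cons; move: (foldr _ _ _) (\prod_(x <- s) _) => f k hf kC.
have -> : comm a f = k * comm a w + comm a (f - k * w).
  by rewrite -commZr // -commDr addrC subrK.
rewrite (commCr _ hf) addr0 (tC Aa) -mulrA -mulrBr; apply: centralM => //.
by have := t_comm Aa Aw; rewrite tw mul0r addr0.
Qed.

Lemma iter_comm_central (s : seq Q) w : {in s, forall x, A x} -> A w -> t w = 0 ->
  (exists2 x, x \in s & t x = 0) \/ C w -> C (foldr (@comm Q) w s).
Proof.
move=> As Aw tw hw; rewrite -(subrK (\prod_(x <- s) t x * w) (foldr _ _ _)).
apply: centralD; first exact: iter_comm_trace.
case: hw => [/(prod_trace_eq0 As) ->|wC]; first by rewrite mul0r; exact: central0.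
exact/centralM/wC/prod_trace_central.
Qed.

Lemma iter_comm_centralN (s : seq Q) w : {in s, forall x, A x} -> A w -> t w = 0 ->
  C (foldr (@comm Q) w s) -> (exists2 x, x \in s & t x = 0) \/ C w.
Proof.
move=> As Aw tw fC; have kC := prod_trace_central As.
have kwC : C (\prod_(x <- s) t x * w).
  have := centralD fC (centralN (iter_comm_trace As Aw tw)).
  by rewrite opprB addrCA subrr addr0.
have [/(prod_trace_eq0 As)|k0] := pselect (\prod_(x <- s) t x = 0); first by left.
right; have [d dC dk] := C_inv kC k0.
by rewrite -(mul1r w) -dk -mulrA; exact: centralM.
Qed.

End TraceForm.

Theorem theoremC (R : primeRngType) (R_exc : exceptional R)
    (L : set R) (L_lie : lie_ideal L) (L_noncentral : ~ (L `<=` rng_center R))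
    (n : nat) (a : (n.+1).-tuple R) :
  (lie_abelian L \/ type_I L ->
     (iter_bracket a L `<=` rng_center R <->
      exists i : 'I_n.+1, set_bracket (RC R) (RC R) (to_Qs (tnth a i))))
  /\
  (type_II L ->
     (iter_bracket a L `<=` rng_center R <->
      rng_center R (tnth a ord_max) \/
      exists i : 'I_n.+1,
        (i < n)%N /\ set_bracket (RC R) (RC R) (to_Qs (tnth a i)))).
Proof.
have [R2 R4] := R_exc; have [L_sub L_ideal] := L_lie.
have char2 := Qs_char2 R2; have C_inv := @Qs_central_inv R; have RC_dep := RC_dep R4.
pose i := @to_Qs R; have RCi r : RC R (i r) by exact: RC_to_Qs.
have LI w r : L w -> L (bracket w r).
  by move=> Lw; apply: L_ideal; apply: sub_additive_span; exists w, r.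
have [w0 [Lw0 w0C]] : exists w, L w /\ ~ central (i w).
  by have [w /not_implyP[Lw wC]] := (existsNP _).2 L_noncentral; exists w; rewrite -to_Qs_center.
have RC_noncomm : exists x y, [/\ RC R x, RC R y & comm x y <> 0].
  have [y Ay xy] := noncentral_comm (@RC_centralizer R) w0C.
  by exists (i w0), y.
have RC_commC := comm_central C_inv (@RC_M R) (@RC_centralizer R).
have [t [tC tcomm tb t0]] := trace_form C_inv (@RC_sub R) (@RC_M R) (@RC_Z R)
  (@RC_prime R) RC_dep (@RC_neq0 R) (@RC_centralizer R) char2 RC_noncomm.
have inC s : {in map i s, forall x, RC R x} by move=> _ /mapP[r _ ->].
have iterP s : iter_bracket s L `<=` rng_center R <->
    forall w, L w -> central (foldr (@comm (Qs R)) (i w) (map i s)).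
  split=> [sub w Lw|sub _ [w Lw <-]].
    by rewrite -to_Qs_iter -to_Qs_center; apply: sub; exists w.
  by rewrite to_Qs_center to_Qs_iter; exact: sub.
split=> [L_type|[L_nonab LC]].
  have tL w : L w -> t (i w) = 0.
    move=> Lw; case: L_type => [L_ab|[_ LC]]; last first.
      rewrite tb //; change (set_bracket (RC R) (RC R) (i w)); rewrite -LC.
      apply: sub_additive_span; exists (i w), 1; split; [by exists w|exact: central1|].
      exact: esym (mulr1 _).
    (* L abelian gives [w, [w, r]] = 0; bracketing the trace formula for [w, r] with w leaves t(w)
       [w, r] = 0. If t(w) were nonzero, w would be central and have trace zero. *)
    apply: contrapT => tw; apply: (tw); apply: t0; apply: Qs_centralizer => r.
    apply/subr0_eq; change (comm (i w) (i r) = 0).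
    have ww : comm (i w) (comm (i w) (i r)) = 0.
      rewrite -!to_Qs_bracket -[RHS]to_Qs0; congr to_Qs.
      have : set_bracket L L (bracket w (bracket w r)).
        by apply: sub_additive_span; exists w, (bracket w r); split=> //; exact: LI.
      by rewrite L_ab.
    have [|//|//] := central_mul_eq0 C_inv (x := comm (i w) (i r)) (tC _ (RCi w)).
    rewrite -commZr; last exact: tC.
    have := commCr (i w) (tcomm _ _ (RCi w) (RCi r)).
    rewrite (opp_char2 char2) commDr ww add0r commDr (commZr _ (i w) (tC _ (RCi r))).
    by rewrite commxx mulr0 addr0.
  have exP : (exists2 x, x \in map i a & t x = 0) <->
      exists j, set_bracket (RC R) (RC R) (to_Qs (tnth a j)).
    split=> [[_ /mapP[r /tnthP[j ->] ->]] /tb tr|[j aj]].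
      by exists j; exact: tr.
    exists (i (tnth a j)); last exact/tb.
    by apply: map_f; exact: mem_tnth.
  rewrite iterP -exP; split=> [sub|ex w Lw].
    (* Testing on the noncentral [w0] rules out the alternative that w is central. *)
    by case: (iter_comm_centralN C_inv tC tcomm (inC a) (RCi w0) (tL _ Lw0) (sub _ Lw0)).
  by apply: (iter_comm_central C_inv tC tcomm (inC a)) => //; [exact: tL|left].
(* Split off a_n, so that the trace-zero element fed to the other brackets is [a_n, w]. *)
have aE : tval a = rcons (take n a) (tnth a ord_max).
  by rewrite (tnth_nth 0) /= -take_nth ?size_tuple // take_oversize // size_tuple.
have exP : (exists2 x, x \in map i (take n a) & t x = 0) <->
    exists j : 'I_n.+1, (j < n)%N /\ set_bracket (RC R) (RC R) (to_Qs (tnth a j)).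
  split=> [[_ /mapP[r /(nthP 0)[k kn <-] ->]] /tb tr|[j [jn aj]]].
    have {}kn : (k < n)%N by rewrite size_take_min size_tuple in kn; apply: leq_trans kn (geq_minl _ _).
    exists (Ordinal (ltnW (kn : (k.+1 < n.+1)%N))); rewrite (tnth_nth 0) /=; split=> //.
    by rewrite -(nth_take 0 kn); exact: tr.
  exists (i (tnth a j)); last exact/tb.
  apply: map_f; rewrite (tnth_nth 0) -(nth_take 0 jn); apply: mem_nth.
  by rewrite size_take_min size_tuple leq_min jn ltn_ord.
set al := tnth a ord_max in aE *.
have t_al w : t (comm (i al) (i w)) = 0.
  apply/tb; first by rewrite -to_Qs_bracket.
  by apply: sub_additive_span; exists (i al), (i w).
have RC_al w : RC R (comm (i al) (i w)) by rewrite -to_Qs_bracket.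
rewrite iterP -exP to_Qs_center; split=> [sub|hyp w Lw].
  apply: contrapT => /not_orP[alC ex]; apply: alC; apply: RC_commC => //.
  (* Centrality of [a_n, w] for w in L extends C-linearly to LC = RC. *)
  rewrite -LC; apply: RC_ind => [|c w hc Lw] /=.
    split=> [|x y xC yC] /=; first by rewrite comm0r; exact: central0.
    by rewrite commDr (opp_char2 char2) //; exact: centralD.
  rewrite commZr //; apply: centralM => //.
  have := sub w Lw; rewrite aE map_rcons foldr_rcons.
  by move=> /(iter_comm_centralN C_inv tC tcomm (inC _) (RC_al w) (t_al w))[].
rewrite aE map_rcons foldr_rcons; apply: (iter_comm_central C_inv tC tcomm (inC _)) => //.
case: hyp => [alC|]; [right|by left].
by rewrite commCl //; exact: central0.
Qed.
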